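(* The complete spelling rules for $RVT$ codes of points of the $\mathbb{R}^3$-Monster Tower are as follows. Here ''$X : Y_1, Y_2, \dots$'' means that the letters $Y_1, Y_2,\dots$ are exactly the letters that can be placed immediately after the letter $X$. 1. Every $RVT$ code begins with the letter $R$. 2. $R$ : $R$ and $V$. 3. $V$ and $T_1$ : $R, V, T_1$ and $L_1$. 4. $L_1$, $L_2$ and $L_3$ : $R, V, T_1, T_2, L_1, L_2$ and $L_3$. 5. $T_2$ : $R, V, T_2$ and $L_3$. That is, for $k\ge 1$, a word $\omega_1\cdots\omega_k$ in the letters $R,V,T_1,T_2,L_1,L_2,L_3$ is the $RVT$ code of some point of $\mathcal{P}^k$ if and only if $\omega_1=R$ and, for each $1\le i<k$, the letter $\omega_{i+1}$ is among those listed after $\omega_i$ in rules 2-5.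
   Context: **Monster Tower.** For a manifold $Z$ with a distribution (constant rank subbundle of $TZ$) $\Delta$ of rank $r$, let $Z^1=\mathbb{P}(\Delta)$ be the manifold of pairs $(p,\ell)$ with $p\in Z$ and $\ell\subset\Delta(p)$ a line, and $\pi(p,\ell)=p$. Its Cartan prolongation is the rank $r$ distribution $\Delta^1(p,\ell)=d\pi_{(p,\ell)}^{-1}(\ell)$. Starting with $\mathcal{P}^0=\mathbb{R}^3$, $\Delta_0=T\mathbb{R}^3$, put $\mathcal{P}^{k}=\mathbb{P}(\Delta_{k-1})$ and $\Delta_k=(\Delta_{k-1})^1$. All $\Delta_k$ have rank 3. The $\mathbb{R}^3$-Monster Tower is the sequence $(\mathcal{P}^k,\Delta_k)$ with projections $\pi_{k,i}:\mathcal{P}^k\to\mathcal{P}^i$. Given $p_k\in\mathcal{P}^k$, write $p_i=\pi_{k,i}(p_k)$, so that $p_i=(p_{i-1},\ell_{i-1})$ with $\ell_{i-1}\subset\Delta_{i-1}(p_{i-1})$. **Baby Monsters and critical planes.** For $i\ge1$ let $F_i(p_i)=\pi_{i,i-1}^{-1}(p_{i-1})\subset\mathcal{P}^i$ be the (2-dimensional) fiber through $p_i$; it is an integral submanifold of $\Delta_i$. Iterating prolongation starting from $(F_i(p_i),TF_i(p_i))$ gives submanifolds $\mathcal{P}^j(F_i(p_i))\subset\mathcal{P}^{i+j}$, $j\ge0$, with rank 2 distributions $\delta_i^j$, $\delta_i^j(q)=\Delta_{i+j}(q)\cap T_q\mathcal{P}^j(F_i(p_i))\subset\Delta_{i+j}(q)$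 for $q\in\mathcal{P}^j(F_i(p_i))$. This subtower is called a Baby Monster born at level $i$, and each such $\delta_i^j(q)$ is called a critical plane in $\Delta_{i+j}(q)$. For $k\ge 1$ the vertical plane $V(p_k)=\delta^0_k(p_k)=T_{p_k}F_k(p_k)$ is always a critical plane in $\Delta_k(p_k)$. **Kumpera-Rubin (KR) coordinates.** Fix $p_k\in\mathcal{P}^k$. Let $(f_0,u_0,v_0)=(x,y,z)$ be the coordinates on $\mathbb{R}^3$. Inductively, near $p_i$ the distribution $\Delta_i$ is coframed by the restrictions of $df_i,du_i,dv_i$. Given $p_{i+1}=(p_i,\ell_i)$, let $f_{i+1}$ be the first function in the ordered list $(f_i,u_i,v_i)$ whose differential does not vanish on $\ell_i$, let $g,h$ be the remaining two functions in the order of the list, and let $u_{i+1}=dg/df_{i+1}$, $v_{i+1}=dh/df_{i+1}$ be the corresponding affine fiber coordinates on $\mathbb{P}(\Delta_i)$ near $p_{i+1}$. Then $V(p_k)=\{df_k=0\}$ in $\Delta_k(p_k)$, for $k\ge1$. **Planes $T_1,T_2$ and lines $L_1,L_2,L_3$.** In $\Delta_k(p_k)$, $k\ge1$: $T_1$ denotes the critical plane different from $V$ given by $du_k=0$, if this plane is critical; $T_2$ denotes the critical plane different from $V$ given by $dv_k=0$, if this plane is critical. Whenever the planes involved are present, $L_1=V\cap T_1$, $L_2=T_1\cap T_2$, $L_3=V\cap T_2$. (The letters $T$ and $L$ without index mean $T_1$ and $L_1$.) **$RVT$ code.** A line $\ell\subset\Delta_k(p_k)$, $k\ge1$, is a critical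 direction if there is an immersed integral curve of $\Delta_k$ through $p_k$ tangent to $\ell$ at $p_k$ whose projection to $\mathcal{P}^0$ is constant; otherwise it is a regular direction. The $RVT$ code of $p_k$ is the word $\omega_1\cdots\omega_k$, where $\omega_1=R$ and, for $2\le i\le k$: $\omega_i=R$ if $\ell_{i-1}$ is a regular direction; if $\ell_{i-1}$ is critical, $\omega_i=L_j$ if $\ell_{i-1}$ is the line $L_j$ in $\Delta_{i-1}(p_{i-1})$, and otherwise $\omega_i$ is whichever of $V,T_1,T_2$ is the critical plane in $\Delta_{i-1}(p_{i-1})$ containing $\ell_{i-1}$. *)

(* Defs.v *)
From HB Require Import structures.
From mathcomp Require Import all_boot all_order all_algebra.
From mathcomp Require Import all_classical all_reals all_analysis.

Set Implicit Arguments.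
Unset Strict Implicit.
Unset Printing Implicit Defensive.

Import Order.TTheory GRing.Theory Num.Theory.
Import numFieldNormedType.Exports.

Local Open Scope classical_set_scope.
Local Open Scope ring_scope.

(* Manifolds are realised as embedded submanifolds Z of some R^n = 'rV[R]_n.  *)
(* A line l of R^n is encoded by the orthogonal projector onto it, a matrix   *)
(* in 'M[R]_n with row space l; thus, if Z is a submanifold of R^n and D a    *)
(* distribution on Z, then P(D) is a submanifold of R^(n + n * n).            *)

Section Submanifolds.
Context {R : realType}.

(* A curve is a germ at t = 0: only its values for t near 0 matter. *)
Definition smooth_germ n (c : R -> 'rV[R]_n) : Prop :=
  \forall t \near (0 : R), forall (i : 'I_n) (m : nat),
    derivable (derive1n m (fun s => c s 0 i)) t 1.

Definition velocity n (c : R -> 'rV[R]_n) (t : R) : 'rV[R]_n :=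
  \row_i derive1 (fun s => c s 0 i) t.

Definition smooth_curve_in n (Z : set 'rV[R]_n) (c : R -> 'rV[R]_n) : Prop :=
  smooth_germ c /\ \forall t \near (0 : R), Z (c t).

Definition has_tangent n (Z : set 'rV[R]_n) (q w : 'rV[R]_n) :
    set (R -> 'rV[R]_n) :=
  [set c | [/\ smooth_curve_in Z c, c 0 = q & velocity c 0 = w]].

Definition tangent n (Z : set 'rV[R]_n) (q : 'rV[R]_n) : set 'rV[R]_n :=
  [set w | has_tangent Z q w !=set0].

(* dg_q(w), for a function g on Z and w in T_q Z; the curve chosen by xget is *)
(* irrelevant when g is smooth on Z near q.                                   *)
Definition differential n (Z : set 'rV[R]_n) (g : 'rV[R]_n -> R)
    (q w : 'rV[R]_n) : R :=
  derive1 (g \o xget (fun=> q) (has_tangent Z q w)) 0.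

Record dspace n := DSpace {
  pts : set 'rV[R]_n;
  dist : 'rV[R]_n -> set 'rV[R]_n }.

Definition full_dspace n (Z : set 'rV[R]_n) : dspace n :=
  DSpace Z (tangent Z).

Definition line_projector n (M : 'M[R]_n) : Prop :=
  [/\ M^T = M, M *m M = M & \rank M = 1%N].

Definition rowspace n (M : 'M[R]_n) : set 'rV[R]_n := [set v | (v <= M)%MS].

(* The two components of a point (p, l) of P(D). *)
Definition base n (q : 'rV[R]_(n + n * n)) : 'rV[R]_n := lsubmx q.
Definition line_mx n (q : 'rV[R]_(n + n * n)) : 'M[R]_n := vec_mx (rsubmx q).
Definition line n (q : 'rV[R]_(n + n * n)) : set 'rV[R]_n :=
  rowspace (line_mx q).

Definition proj_bundle n (D : dspace n) : set 'rV[R]_(n + n * n) :=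
  [set q | [/\ pts D (base q), line_projector (line_mx q)
             & line q `<=` dist D (base q)]].

(* The bundle projection is the restriction of the linear map base, so base   *)
(* is also its differential.                                                  *)
Definition prolongation n (D : dspace n) : dspace (n + n * n) :=
  DSpace (proj_bundle D)
    (fun q => [set w | tangent (proj_bundle D) q w /\ line q (base w)]).

End Submanifolds.

Fixpoint amb_dim (k : nat) : nat :=
  if k is k'.+1 then (amb_dim k' + amb_dim k' * amb_dim k')%N else 3%N.

Inductive letter := lR | lV | lT1 | lT2 | lL1 | lL2 | lL3.

Lemma letter_comparable : comparable letter.
Proof. by move=> a b; rewrite /decidable; decide equality. Qed.
HB.instance Definition _ :=
  hasDecEq.Build letter (compareP letter_comparable).

Section Monster.
Context {R : realType}.

Fixpoint monster (k : nat) : dspace (R := R) (amb_dim k) :=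
  match k with
  | 0 => full_dspace setT
  | k'.+1 => prolongation (monster k')
  end.

Local Notation P k := (pts (monster k)).
Local Notation Delta k := (dist (monster k)).

Fixpoint to_R3 (k : nat) : 'rV[R]_(amb_dim k) -> 'rV[R]_3 :=
  match k with
  | 0 => id
  | k'.+1 => fun q => to_R3 (base q)
  end.

Definition fiber k (p : 'rV[R]_(amb_dim k.+1)) : set 'rV[R]_(amb_dim k.+1) :=
  [set q | P k.+1 q /\ base q = base p].

(* baby_monster B: B is a stage P^j(F_i(p_i)), i >= 1, of a Baby Monster, with *)
(* its distribution, and k = i + j.                                           *)
Inductive baby_monster : forall k, dspace (R := R) (amb_dim k) -> Prop :=
| baby_birth i (p : 'rV[R]_(amb_dim i.+1)) :
    P i.+1 p -> @baby_monster i.+1 (full_dspace (fiber p))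
| baby_prolong k (B : dspace (amb_dim k)) :
    baby_monster B -> @baby_monster k.+1 (prolongation B).

Definition critical_plane k (p : 'rV[R]_(amb_dim k)) (S : set 'rV[R]_(amb_dim k)) :=
  exists B : dspace (amb_dim k), [/\ baby_monster B, pts B p & S = dist B p].

Record kr_coords n :=
  KRCoords { kr_f : 'rV[R]_n -> R; kr_u : 'rV[R]_n -> R; kr_v : 'rV[R]_n -> R }.

Definition nonvanishing n (Z : set 'rV[R]_n) (g : 'rV[R]_n -> R)
    (q : 'rV[R]_n) (l : set 'rV[R]_n) : Prop :=
  exists2 w, l w & differential Z g q w != 0.

(* The fiber coordinate dg/df on lines; nz_row picks a nonzero vector of the  *)
(* line.                                                                      *)
Definition fiber_coord n (Z : set 'rV[R]_n) (g f : 'rV[R]_n -> R)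
    (q : 'rV[R]_(n + n * n)) : R :=
  differential Z g (base q) (nz_row (line_mx q)) /
  differential Z f (base q) (nz_row (line_mx q)).

Definition kr_next n (Z : set 'rV[R]_n) (C : kr_coords n)
    (p : 'rV[R]_(n + n * n)) : kr_coords (n + n * n) :=
  let: KRCoords f u v := C in
  let coords f' g h :=
    KRCoords (f' \o @base R n) (fiber_coord Z g f') (fiber_coord Z h f') in
  if `[< nonvanishing Z f (base p) (line p) >] then coords f u v
  else if `[< nonvanishing Z u (base p) (line p) >] then coords u f v
  else coords v f u.

Fixpoint kr (k : nat) : 'rV[R]_(amb_dim k) -> kr_coords (amb_dim k) :=
  match k with
  | 0 => fun=> KRCoords (fun q : 'rV[R]_3 => q 0 0) (fun q : 'rV[R]_3 => q 0 1)
                        (fun q : 'rV[R]_3 => q 0 2%:R)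
  | k'.+1 => fun p => kr_next (P k') (kr (base p)) p
  end.

Definition plane_zero k (p : 'rV[R]_(amb_dim k)) (g : 'rV[R]_(amb_dim k) -> R) :
    set 'rV[R]_(amb_dim k) :=
  [set w | Delta k p w /\ differential (P k) g p w = 0].

Definition planeV k (p : 'rV[R]_(amb_dim k.+1)) : set 'rV[R]_(amb_dim k.+1) :=
  tangent (fiber p) p.

Definition planeT1 k (p : 'rV[R]_(amb_dim k)) := plane_zero p (kr_u (kr p)).
Definition planeT2 k (p : 'rV[R]_(amb_dim k)) := plane_zero p (kr_v (kr p)).

Definition has_T1 k (p : 'rV[R]_(amb_dim k.+1)) : Prop :=
  critical_plane p (planeT1 p) /\ planeT1 p <> planeV p.
Definition has_T2 k (p : 'rV[R]_(amb_dim k.+1)) : Prop :=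
  critical_plane p (planeT2 p) /\ planeT2 p <> planeV p.

Definition is_L1 k (p : 'rV[R]_(amb_dim k.+1)) (l : set 'rV[R]_(amb_dim k.+1)) :=
  has_T1 p /\ l = planeV p `&` planeT1 p.
Definition is_L2 k (p : 'rV[R]_(amb_dim k.+1)) (l : set 'rV[R]_(amb_dim k.+1)) :=
  [/\ has_T1 p, has_T2 p & l = planeT1 p `&` planeT2 p].
Definition is_L3 k (p : 'rV[R]_(amb_dim k.+1)) (l : set 'rV[R]_(amb_dim k.+1)) :=
  has_T2 p /\ l = planeV p `&` planeT2 p.
Definition is_L k (p : 'rV[R]_(amb_dim k.+1)) (l : set 'rV[R]_(amb_dim k.+1)) :=
  [\/ is_L1 p l, is_L2 p l | is_L3 p l].

Definition critical_direction k (p : 'rV[R]_(amb_dim k))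
    (l : set 'rV[R]_(amb_dim k)) : Prop :=
  exists c : R -> 'rV[R]_(amb_dim k),
    [/\ smooth_curve_in (P k) c, c 0 = p, l (velocity c 0) &
        \forall t \near (0 : R),
          [/\ velocity c t != 0, Delta k (c t) (velocity c t)
            & to_R3 (c t) = to_R3 p]].

(* The letter attached to a line l in Delta_k+1(p). *)
Definition direction_letter k (p : 'rV[R]_(amb_dim k.+1))
    (l : set 'rV[R]_(amb_dim k.+1)) (a : letter) : Prop :=
  match a with
  | lR => ~ critical_direction p l
  | lL1 => critical_direction p l /\ is_L1 p l
  | lL2 => critical_direction p l /\ is_L2 p l
  | lL3 => critical_direction p l /\ is_L3 p l
  | lV => [/\ critical_direction p l, ~ is_L p l & l `<=` planeV p]
  | lT1 => [/\ critical_direction p l, ~ is_L p l, has_T1 p & l `<=` planeT1 p]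
  | lT2 => [/\ critical_direction p l, ~ is_L p l, has_T2 p & l `<=` planeT2 p]
  end.

(* RVT_code p w: the word w is the RVT code of p, for p at level k >= 1. *)
Inductive RVT_code : forall k, 'rV[R]_(amb_dim k) -> seq letter -> Prop :=
| RVT_first (p : 'rV[R]_(amb_dim 1)) : @RVT_code 1 p [:: lR]
| RVT_next k (p : 'rV[R]_(amb_dim k.+2)) (w : seq letter) (a : letter) :
    @RVT_code k.+1 (base p) w -> @direction_letter k (base p) (line p) a ->
    @RVT_code k.+2 p (rcons w a).

End Monster.

Definition followers (a : letter) : seq letter :=
  match a with
  | lR => [:: lR; lV]
  | lV | lT1 => [:: lR; lV; lT1; lL1]
  | lL1 | lL2 | lL3 => [:: lR; lV; lT1; lT2; lL1; lL2; lL3]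
  | lT2 => [:: lR; lV; lT2; lL3]
  end.

(* Main.v *)
(* In the Kumpera-Rubin coordinates f_k, u_k, v_k the critical planes of        *)
(* Delta_k(p_k) are coordinate planes. The fiber direction is {df_k = 0}, and a *)
(* critical plane {dg = 0}, g in (f_k, u_k, v_k), is inherited at level k + 1   *)
(* exactly when it contains the line l_k: then g is not f_k+1, so dg / df_k+1   *)
(* is u_k+1 or v_k+1, it vanishes on the prolonged Baby Monster, and the plane  *)
(* becomes {du_k+1 = 0} or {dv_k+1 = 0}. Hence which of T_1, T_2 exist at       *)
(* level k + 1, and the letter of l_k, only depend on which of them exist at    *)
(* level k and on which of df_k, du_k, dv_k vanish on l_k, and any nontrivial   *)
(* vanishing pattern occurs. The letter just written turns out to determine     *)
(* which of T_1, T_2 exist, which gives the rules.                              *)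
(* A line in a critical plane is critical because integral curves are found by  *)
(* quadrature from their top coordinates, so a Baby Monster carries curves      *)
(* tangent to the line. Conversely, if c is integral and no critical coordinate *)
(* of level k is stationary along c at times t <> 0 near 0, then by Rolle's     *)
(* theorem the same holds one level below, and c moves in R^3.                  *)

(* The differential geometry is concentrated in one invariant, [chart]: three functions whose
   differentials coframe a rank 3 distribution, together with integral curves along which these
   functions are prescribed polynomials. [chart_prolong] carries it through a Cartan prolongation,
   so by [monster_chart] the Kumpera-Rubin functions chosen at p form a chart around p, and
   questions about Delta_k become questions about three scalar functions. In such a chart
   [critical_planeP] identifies the critical planes with the coordinate planes recorded by [crit],
   and [critical_directionP] the critical directions with the lines inside them. One prolongation
   step is then Boolean: [direction_letterP], [next_T1P] and [next_T2P] compute the letter of a line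
   and the new planes T_1, T_2 from the old ones and from the vanishing of the three differentials
   on the line. The tables [has_T1_after] and [has_T2_after] close the induction. The finite check
   [letter_spec_follows] makes the rules necessary ([RVT_code_sound]); [followers_letter_spec] finds
   a vanishing pattern for each allowed letter, and any nontrivial pattern is realised by a line,
   whence sufficiency ([RVT_code_complete]). *)
Require Import Defs.
From mathcomp Require Import all_boot all_order all_algebra.
From mathcomp Require Import all_classical all_reals all_analysis.
From mathcomp Require Import ring.

Set Implicit Arguments.
Unset Strict Implicit.
Unset Printing Implicit Defensive.

Import Order.TTheory GRing.Theory Num.Theory.
Import numFieldNormedType.Exports.

(** * Smooth germs of scalar functions *)

Section SmoothScalars.
Local Open Scope classical_set_scope.
Local Open Scope ring_scope.
Context {R : realType}.
Implicit Types (f g : R -> R) (t : R) (O : set R).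

Lemma is_derive1E f t d : is_derive t (1 : R) f d -> derive1 f t = d.
Proof. by move=> fd; rewrite derive1E derive_val. Qed.

Lemma is_derive1_eq f t a b : is_derive t (1 : R) f a -> a = b -> is_derive t (1 : R) f b.
Proof. by move=> fa <-. Qed.

Lemma derivable_is_derive1 f t : derivable f t 1 -> is_derive t (1 : R) f (derive1 f t).
Proof. by move=> fd; rewrite derive1E; exact: derivableP. Qed.

Lemma is_derive_near f g t d :
  (\forall s \near t, f s = g s) -> is_derive t (1 : R) g d -> is_derive t (1 : R) f d.
Proof.
by move=> fg; apply: near_eq_is_derive; apply: filterS fg => s ->.
Qed.

Lemma derive1_near f g t :
  (\forall s \near t, f s = g s) -> derive1 f t = derive1 g t.
Proof. by move=> fg; rewrite !derive1E; exact: near_eq_derive. Qed.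

Lemma is_derive1D f g t a b : is_derive t (1 : R) f a -> is_derive t (1 : R) g b ->
  is_derive t (1 : R) (fun s => f s + g s) (a + b).
Proof. exact: is_deriveD. Qed.

Lemma is_derive1M f g t a b : is_derive t (1 : R) f a -> is_derive t (1 : R) g b ->
  is_derive t (1 : R) (fun s => f s * g s) (a * g t + f t * b).
Proof.
move=> [fd <-] [gd <-]; have := @deriveM _ _ f g t 1 fd gd.
rewrite addrC [X in X + _]mulrC => <-; exact: (derivableP (derivableM fd gd)).
Qed.

Lemma is_derive1V f t a : f t != 0 -> is_derive t (1 : R) f a ->
  is_derive t (1 : R) (fun s => (f s)^-1) (- (f t)^-2 * a).
Proof.
move=> ft0 fa; apply: DeriveDef; first by apply: derivableV.
by rewrite deriveV// derive_val.
Qed.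

Lemma derivable_continuous f t : derivable f t 1 -> {for t, continuous f}.
Proof. by move=> fd; apply/differentiable_continuous/derivable1_diffP. Qed.

Lemma near_neq0 f t : {for t, continuous f} -> f t != 0 -> \forall s \near t, f s != 0.
Proof.
move=> fc ft; have := @open_neq R 0; rewrite openE => /(_ _ ft).
by move/fc.
Qed.

Lemma near_openP (P : R -> Prop) t :
  (\forall s \near t, P s) <-> exists O, [/\ open O, O t & O `<=` P].
Proof.
rewrite /prop_near1 nbhsE; split=> [[ O [oO Ot] OP]|[ O [oO Ot OP]]].
  by exists O.
by exists O.
Qed.

(** Smoothness is truncated at order m so that closure under products and inverses goes by induction
    on m, the function being generalised. The open set O is fixed, which allows equalities on O to
    be differentiated. *)
Fixpoint derivable_upto (m : nat) O f : Prop :=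
  if m is m'.+1 then
    (forall t, O t -> derivable f t 1) /\ derivable_upto m' O (derive1 f)
  else True.

Lemma derivable_uptoP O f :
  (forall t m, O t -> derivable (derive1n m f) t 1) <->
  forall m, derivable_upto m O f.
Proof.
split=> [fd m|fd t m].
  elim: m f fd => [//|m IH] f fd; split=> [t Ot|]; first exact: (fd t 0%N).
  by apply: IH => t j Ot; rewrite -derive1Sn; exact: fd.
elim: m f fd => [|m IH] f fd Ot; first by have [/(_ t Ot)] := fd 1%N.
by rewrite derive1Sn; apply: IH => // j; have [] := fd j.+1.
Qed.

Lemma derivable_upto_ext m O f g : open O -> (forall t, O t -> f t = g t) ->
  derivable_upto m O f -> derivable_upto m O g.
Proof.
move=> oO; elim: m f g => [//|m IH] f g fg [fd fm]; split.
  move=> t Ot; apply: (near_eq_derivable _ (fd t Ot)).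
  by apply: filterS (open_nbhs_nbhs (conj oO Ot)) => s; exact: fg.
apply: IH fm => t Ot; apply: derive1_near.
by apply: filterS (open_nbhs_nbhs (conj oO Ot)) => s; exact: fg.
Qed.

Lemma derivable_uptoW m O f : derivable_upto m.+1 O f -> derivable_upto m O f.
Proof.
by elim: m f => [//|m IH] f [fd fm]; split => //; apply: IH.
Qed.

Lemma derivable_uptoD m O f g : open O -> derivable_upto m O f ->
  derivable_upto m O g -> derivable_upto m O (fun t => f t + g t).
Proof.
move=> oO; elim: m f g => [//|m IH] f g [fd fm] [gd gm]; split=> [t Ot|].
  by apply: derivableD; [exact: fd|exact: gd].
apply: derivable_upto_ext (IH _ _ fm gm) => // t Ot; apply/esym/is_derive1E.
by apply: is_derive1D; apply: derivable_is_derive1; [exact: fd|exact: gd].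
Qed.

Lemma derivable_uptoM m O f g : open O -> derivable_upto m O f ->
  derivable_upto m O g -> derivable_upto m O (fun t => f t * g t).
Proof.
move=> oO; elim: m f g => [//|m IH] f g fm gm.
have [fd f'm] := fm; have [gd g'm] := gm; split=> [t Ot|].
  by apply: derivableM; [exact: fd|exact: gd].
have := derivable_uptoD oO (IH _ _ f'm (derivable_uptoW gm))
  (IH _ _ (derivable_uptoW fm) g'm).
apply: derivable_upto_ext => // t Ot; apply/esym/is_derive1E.
by apply: is_derive1M; apply: derivable_is_derive1; [exact: fd|exact: gd].
Qed.

Lemma derivable_upto_cst m O (a : R) : open O -> derivable_upto m O (fun=> a).
Proof.
move=> oO; elim: m a => [//|m IH] a; split=> [t Ot|]; first exact: derivable_cst.
by apply: derivable_upto_ext (IH 0) => // t Ot; rewrite derive1_cst.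
Qed.

(** The derivative -(1/f)(1/f)f' of 1/f needs 1/f only to one order less, which the induction
    provides. *)
Lemma derivable_uptoV m O f : open O -> (forall t, O t -> f t != 0) ->
  derivable_upto m O f -> derivable_upto m O (fun t => (f t)^-1).
Proof.
move=> oO f0; elim: m => [//|m IH] fm; have [fd f'm] := fm.
have fV := IH (derivable_uptoW fm).
split=> [t Ot|]; first by apply: derivableV; [exact: f0|exact: fd].
have := derivable_uptoM oO (derivable_uptoM oO (derivable_uptoM oO fV fV)
  (derivable_upto_cst m (-1) oO)) f'm.
apply: derivable_upto_ext => // t Ot; apply/esym/is_derive1E.
rewrite mulrN1 -expr2 exprVn; apply: is_derive1V; first exact: f0.
by apply: derivable_is_derive1; exact: fd.
Qed.

Lemma derivable_upto_horner m O (p : {poly R}) :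
  derivable_upto m O (fun t => p.[t]).
Proof.
elim: m p => [//|m IH] p; split=> [t _|]; first exact: derivable_horner.
by have := IH p^`(); rewrite derivE.
Qed.

Definition smooth0 f : Prop :=
  \forall t \near (0 : R), forall m, derivable (derive1n m f) t 1.

Lemma smooth0P f :
  smooth0 f <->
  exists O, [/\ open O, O 0 & forall m, derivable_upto m O f].
Proof.
split.
  move=> /near_openP[ O [oO O0 Of]]; exists O; split=> //.
  by apply/derivable_uptoP; move=> t m Ot; exact: Of.
move=> [ O [oO O0 fO]]; apply/near_openP; exists O; split=> // t Ot m.
by apply: (derivable_uptoP O f).2.
Qed.

Lemma derivable_upto_sub m O O' f : O' `<=` O -> derivable_upto m O f ->
  derivable_upto m O' f.
Proof.
move=> OO'; elim: m f => [//|m IH] f [fd fm]; split; last exact: IH.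
by move=> t /OO'; exact: fd.
Qed.

Lemma smooth0_op2 (op : R -> R -> R) f g :
  (forall m O f g, open O -> derivable_upto m O f -> derivable_upto m O g ->
   derivable_upto m O (fun t => op (f t) (g t))) ->
  smooth0 f -> smooth0 g -> smooth0 (fun t => op (f t) (g t)).
Proof.
move=> opd /smooth0P[ O [oO O0 fO]] /smooth0P[U [oU U0 gU]]; apply/smooth0P.
exists (O `&` U); split; [exact: openI|by []|]; move=> m.
apply: opd; first exact: openI.
- by apply: derivable_upto_sub (fO m) => t [].
- by apply: derivable_upto_sub (gU m) => t [].
Qed.

Lemma smooth0D f g : smooth0 f -> smooth0 g -> smooth0 (fun t => f t + g t).
Proof. by apply: smooth0_op2 => *; apply: derivable_uptoD. Qed.

Lemma smooth0M f g : smooth0 f -> smooth0 g -> smooth0 (fun t => f t * g t).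
Proof. by apply: smooth0_op2 => *; apply: derivable_uptoM. Qed.

Lemma smooth0_horner (p : {poly R}) : smooth0 (fun t => p.[t]).
Proof.
apply/smooth0P; exists setT; split=> // [|m]; first exact: openT.
exact: derivable_upto_horner.
Qed.

Lemma smooth0_cst (a : R) : smooth0 (fun=> a).
Proof.
apply/smooth0P; exists setT; split=> // [|m]; last apply: derivable_upto_cst.
- exact: openT.
- exact: openT.
Qed.

Lemma smooth0_near f g : (\forall t \near (0 : R), f t = g t) -> smooth0 f -> smooth0 g.
Proof.
move=> /near_openP[U [oU U0 fg]] /smooth0P[ O [oO O0 fO]]; apply/smooth0P.
exists (O `&` U); split; [exact: openI|by []|]; move=> m.
apply: (@derivable_upto_ext _ _ f); first exact: openI.
  by move=> t [_ /fg].
by apply: derivable_upto_sub (fO m) => t [].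
Qed.

Lemma smooth0_derivable f : smooth0 f -> \forall t \near (0 : R), derivable f t 1.
Proof. by apply: filterS => t /(_ 0%N). Qed.

Lemma smooth0_derivable0 f : smooth0 f -> derivable f 0 1.
Proof. by move=> /smooth0_derivable/nbhs_singleton. Qed.

Lemma smooth0_derive1 f : smooth0 f -> smooth0 (derive1 f).
Proof. by apply: filterS => t fd m; rewrite -derive1Sn. Qed.

Lemma smooth0_continuous f : smooth0 f -> {for 0, continuous f}.
Proof. by move/smooth0_derivable0/derivable_continuous. Qed.

Lemma smooth0V f : f 0 != 0 -> smooth0 f -> smooth0 (fun t => (f t)^-1).
Proof.
move=> f0 fs; have := near_neq0 (smooth0_continuous fs) f0.
move=> /near_openP[U [oU U0 fU]].
have /smooth0P[ O [oO O0 fO]] := fs; apply/smooth0P.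
exists (O `&` U); split; [exact: openI|by []|]; move=> m.
apply: derivable_uptoV; [exact: openI|by move=> t [_ /fU]|].
by apply: derivable_upto_sub (fO m) => t [].
Qed.

(** A ball around 0 is convex. This is the form in which the mean value theorem and Rolle's theorem
    can use a condition valid near 0. *)
Lemma near0_segments (P : R -> Prop) : (\forall t \near (0 : R), P t) ->
  \forall t \near (0 : R),
    (forall s, s \in `[0, t] -> P s) /\ (forall s, s \in `[t, 0] -> P s).
Proof.
move=> /nbhs_ballP[e /= e0 Pe]; apply/nbhs_ballP; exists e => // t te.
split=> s; rewrite in_itv /= => /andP[s1 s2]; apply: Pe; move: te;
  rewrite /ball /= !sub0r !normrN; apply: le_lt_trans.
  by rewrite !ger0_norm // (le_trans s1).
by rewrite !ler0_norm ?lerN2 // (le_trans s1).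
Qed.

Lemma derive1_eq0_near_cst f : (\forall t \near (0 : R), is_derive t (1 : R) f 0) ->
  \forall t \near (0 : R), f t = f 0.
Proof.
move=> /near0_segments; apply: filterS => t [fp fn].
case: (ltgtP 0 t) => [t0|t0|<-//].
- have := @MVT R f (fun=> 0) 0 t t0.
  have fc : {within `[0, t], continuous f}.
    by apply: derivable_within_continuous => s st; have [] := fp s st.
  have fd x : x \in `]0, t[%R -> is_derive x (1 : R) f 0.
    by move=> xt; apply: fp; exact: subset_itv_oo_cc xt.
  move=> /(_ fd fc)[c _].
  by rewrite mul0r => /eqP; rewrite subr_eq0 => /eqP.
- have := @MVT R f (fun=> 0) t 0 t0.
  have fc : {within `[t, 0], continuous f}.
    by apply: derivable_within_continuous => s st; have [] := fn s st.
  have fd x : x \in `]t, 0[%R -> is_derive x (1 : R) f 0.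
    by move=> xt; apply: fn; exact: subset_itv_oo_cc xt.
  move=> /(_ fd fc)[c _].
  by rewrite mul0r => /eqP; rewrite subr_eq0 => /eqP.
Qed.

(** If [f t = f 0], Rolle's theorem gives a stationary point strictly between 0 and t, hence
    different from 0. *)
Lemma near_neq_of_derive1 f : smooth0 f ->
  (\forall t \near (0 : R), t != 0 -> derive1 f t != 0) ->
  \forall t \near (0 : R), t != 0 -> f t != f 0.
Proof.
move=> /smooth0_derivable fd f'0.
have {}fd : \forall t \near (0 : R),
    derivable f t 1 /\ (t != 0 -> derive1 f t != 0) by exact: filterI.
move: fd => /near0_segments; apply: filterS => t [fp fn] tn0.
(* Serves both signs of t: the condition on a and b says that 0 is not interior to the segment, so
   Rolle's point is nonzero. *)
have key a b : a < b -> (0 < b -> 0 <= a) ->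
    (forall s, s \in `[a, b] -> derivable f s 1 /\ (s != 0 -> derive1 f s != 0)) ->
    f a != f b.
  move=> ab ab0 H; apply/eqP => fab.
  have fc : {within `[a, b], continuous f}.
    by apply: derivable_within_continuous => s st; have [] := H s st.
  have fd x : x \in `]a, b[%R -> derivable f x 1.
    by move=> xt; have [] := H x (subset_itv_oo_cc xt).
  have [c cab /is_derive1E] := Rolle ab fd fc fab.
  have [_ ] := H c (subset_itv_oo_cc cab).
  move=> cN /eqP; apply/negP/cN; move: cab; rewrite in_itv /= => /andP[ac cb].
  have [b0|b0] := ltP 0 b; first by rewrite gt_eqF // (le_lt_trans (ab0 b0)).
  by rewrite lt_eqF // (lt_le_trans cb).
case: (ltgtP 0 t) tn0 => [t0 _|t0 _|<-]; last by rewrite eqxx.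
- by rewrite eq_sym; apply: key => // s st; apply: fp.
- by apply: key => //; rewrite ltxx.
Qed.
End SmoothScalars.

(** * Regular functions and their gradients *)

Section RegularFunctions.
Local Open Scope classical_set_scope.
Local Open Scope ring_scope.
Context {R : realType}.

Definition dot n (u w : 'rV[R]_n) : R := \sum_j u 0 j * w 0 j.

Lemma dotDr n (u w w' : 'rV[R]_n) : dot u (w + w') = dot u w + dot u w'.
Proof. by rewrite /dot -big_split/=; apply: eq_bigr => j _; rewrite mxE mulrDr. Qed.

Lemma dotZr n (u w : 'rV[R]_n) a : dot u (a *: w) = a * dot u w.
Proof. by rewrite /dot mulr_sumr; apply: eq_bigr => j _; rewrite mxE mulrCA. Qed.

Lemma dot0r n (u : 'rV[R]_n) : dot u 0 = 0.
Proof. by rewrite /dot big1// => j _; rewrite mxE mulr0. Qed.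

Lemma dot_sumr n (u : 'rV[R]_n) (I : finType) (a : I -> R) (w : I -> 'rV[R]_n) :
  dot u (\sum_i a i *: w i) = \sum_i a i * dot u (w i).
Proof.
apply: (big_rec2 (fun x y => dot u x = y)); first exact: dot0r.
by move=> i x y _ <-; rewrite dotDr dotZr.
Qed.

Lemma dot_self_eq0 n (u : 'rV[R]_n) : (dot u u == 0) = (u == 0).
Proof.
apply/idP/eqP => [|->]; last by rewrite dot0r.
rewrite /dot psumr_eq0 => [/allP u0|j _]; last by rewrite -expr2 sqr_ge0.
apply/rowP => j; have := u0 j (mem_index_enum _).
by rewrite mxE -expr2 sqrf_eq0 => /eqP.
Qed.

Definition curve_derivable n (c : R -> 'rV[R]_n) t :=
  forall j, derivable (fun s => c s 0 j) t 1.

Lemma smooth_germP n (c : R -> 'rV[R]_n) :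
  smooth_germ c <-> forall j, smooth0 (fun s => c s 0 j).
Proof.
split=> [cs j|cs]; first by apply: filterS cs => t /(_ j).
exact: (@filter_forall R _ (fun j t => forall m,
  derivable (derive1n m (fun s => c s 0 j)) t 1) (nbhs (0 : R)) _ cs).
Qed.

Lemma smooth_germ_derivable n (c : R -> 'rV[R]_n) :
  smooth_germ c -> \forall t \near (0 : R), curve_derivable c t.
Proof. by apply: filterS => t ct j; exact: (ct j 0%N). Qed.

Lemma velocity_near n (c d : R -> 'rV[R]_n) t :
  (\forall s \near t, c s = d s) -> velocity c t = velocity d t.
Proof.
move=> cd; apply/rowP => j; rewrite !mxE; apply: derive1_near.
by apply: filterS cd => s ->.
Qed.

Lemma near_cst_of_velocity n (c : R -> 'rV[R]_n) :
  (\forall t \near (0 : R), curve_derivable c t /\ velocity c t = 0) ->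
  \forall t \near (0 : R), c t = c 0.
Proof.
move=> c0; have : \forall t \near (0 : R), forall j, c t 0 j = c 0 0 j.
  apply: (@filter_forall R _ (fun j t => c t 0 j = c 0 0 j) (nbhs (0 : R)) _) => j.
  apply: (@derive1_eq0_near_cst _ (fun s => c s 0 j)).
  apply: filterS c0 => t [cd /rowP/(_ j)]; rewrite !mxE => <-.
  exact: derivable_is_derive1.
by apply: filterS => t ct; apply/rowP.
Qed.

(** Functions agreeing on W with a rational function without poles on W. They replace smooth
    functions on a submanifold W that need not be open in the ambient space; [regular_ext] admits
    functions defined by choice, such as [fiber_coord]. *)
Inductive regular n (W : set 'rV[R]_n) : ('rV[R]_n -> R) -> Prop :=
| regular_cst a : regular W (fun=> a)
| regular_coord j : regular W (fun q => q 0 j)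
| regularD g h : regular W g -> regular W h -> regular W (fun q => g q + h q)
| regularM g h : regular W g -> regular W h -> regular W (fun q => g q * h q)
| regularV g : (forall q, W q -> g q != 0) -> regular W g ->
    regular W (fun q => (g q)^-1)
| regular_ext g h : (forall q, W q -> g q = h q) -> regular W g -> regular W h.

Lemma regular_sum n (W : set 'rV[R]_n) (I : finType) (g : I -> 'rV[R]_n -> R) :
  (forall i, regular W (g i)) -> regular W (fun q => \sum_i g i q).
Proof.
move=> gW; apply: (regular_ext (g := fun q => (\sum_i g i) q)).
  by move=> q _; rewrite fct_sumE.
apply: (big_ind (regular W)) => //; first exact: (regular_cst W 0).
exact: regularD.
Qed.

Lemma regular_dot n m (W : set 'rV[R]_n) (u w : 'rV[R]_n -> 'rV[R]_m) :
  (forall j, regular W (fun q => u q 0 j)) ->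
  (forall j, regular W (fun q => w q 0 j)) -> regular W (fun q => dot (u q) (w q)).
Proof. by move=> uW wW; apply: regular_sum => j; apply: regularM. Qed.

Lemma regular_comp n m (W : set 'rV[R]_n) (W' : set 'rV[R]_m)
    (k : 'rV[R]_m -> 'rV[R]_n) g :
  (forall j, regular W' (fun q => k q 0 j)) -> (forall q, W' q -> W (k q)) ->
  regular W g -> regular W' (fun q => g (k q)).
Proof.
move=> kW kWW; elim=> {g}.
- by move=> a; exact: (regular_cst W' a).
- exact: kW.
- by move=> g h _ ? _ ?; exact: regularD.
- by move=> g h _ ? _ ?; exact: regularM.
- by move=> g g0 _ ?; apply: regularV => // q /kWW /g0.
- by move=> g h gh _; apply: regular_ext => q /kWW /gh.
Qed.

Lemma smooth0_regular n (W : set 'rV[R]_n) g c : smooth_germ c ->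
  (\forall t \near (0 : R), W (c t)) -> regular W g -> smooth0 (fun t => g (c t)).
Proof.
move=> /smooth_germP cs cW; elim=> {g}.
- by move=> a; exact: smooth0_cst.
- exact: cs.
- by move=> g h _ ? _ ?; exact: smooth0D.
- by move=> g h _ ? _ ?; exact: smooth0M.
- by move=> g g0 _ ?; apply: smooth0V => //; apply: g0; exact: nbhs_singleton cW.
- move=> g h gh _; apply: smooth0_near; apply: filterS cW => t; exact: gh.
Qed.

(** Only curves staying in W are tested, so G is constrained only on velocities of such curves: it
    is an ambient representative of the differential of g along W. *)
Definition gradient n (W : set 'rV[R]_n) (g : 'rV[R]_n -> R)
    (G : 'rV[R]_n -> 'rV[R]_n) :=
  forall c t, curve_derivable c t -> (\forall s \near t, W (c s)) ->
    is_derive t (1 : R) (fun s => g (c s)) (dot (G (c t)) (velocity c t)).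

Lemma regular_gradient n (W : set 'rV[R]_n) g : regular W g ->
  exists G : 'rV[R]_n -> 'rV[R]_n,
    (forall j, regular W (fun q => G q 0 j)) /\ gradient W g G.
Proof.
elim=> {g}.
- move=> a; exists (fun=> 0); split=> [j|c t cd cW].
    by apply: (regular_ext (g := fun=> 0)) => [q _|]; [rewrite mxE|exact: regular_cst].
  rewrite /dot big1; first exact: is_derive_cst.
  by move=> j _; rewrite mxE mul0r.
- move=> j; exists (fun=> delta_mx 0 j); split=> [i|c t cd cW].
    exact: (regular_cst W (delta_mx 0 j 0 i)).
  rewrite /dot (bigD1 j)//= big1 ?addr0 => [|i ij].
    by rewrite !mxE !eqxx mul1r; exact: derivable_is_derive1.
  by rewrite mxE (negbTE ij) andbF mul0r.
- move=> g h gW [G [GW gG]] hW [H [HW hH]].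
  exists (fun q => G q + H q); split=> [j|c t cd cW].
    by apply: (regular_ext (g := fun q => G q 0 j + H q 0 j)) => [q _|];
      [rewrite mxE|exact: regularD].
  rewrite /dot; under eq_bigr do rewrite mxE mulrDl.
  by rewrite big_split; apply: is_derive1D; [exact: gG|exact: hH].
- move=> g h gW [G [GW gG]] hW [H [HW hH]].
  exists (fun q => h q *: G q + g q *: H q); split=> [j|c t cd cW].
    apply: (regular_ext (g := fun q => h q * G q 0 j + g q * H q 0 j)) => [q _|].
      by rewrite !mxE.
    by apply: regularD; apply: regularM.
  apply: is_derive1_eq (is_derive1M (gG c t cd cW) (hH c t cd cW)) _.
  rewrite /dot mulr_suml mulr_sumr -big_split/=.
  by apply: eq_bigr => j _; rewrite !mxE; ring.
- move=> g g0 gW [G [GW gG]].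
  exists (fun q => - (g q)^-2 *: G q); split=> [j|c t cd cW].
    apply: (regular_ext (g := fun q => (-1 * ((g q)^-1 * (g q)^-1)) * G q 0 j)) => [q _|].
      by rewrite !mxE mulN1r -expr2 exprVn.
    apply: regularM => //; apply: regularM; first exact: (regular_cst W (-1)).
    by apply: regularM; apply: regularV.
  apply: is_derive1_eq (is_derive1V (g0 _ (nbhs_singleton cW)) (gG c t cd cW)) _.
  rewrite /dot mulr_sumr.
  by apply: eq_bigr => j _; rewrite !mxE mulrA.
- move=> g h gh gW [G [GW gG]]; exists G; split=> // c t cd cW.
  by apply: is_derive_near (gG c t cd cW); apply: filterS cW => s /gh.
Qed.

Lemma smooth_germ_regular n m (W : set 'rV[R]_n) (k : 'rV[R]_n -> 'rV[R]_m) c :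
  smooth_germ c -> (\forall t \near (0 : R), W (c t)) ->
  (forall j, regular W (fun q => k q 0 j)) -> smooth_germ (fun t => k (c t)).
Proof.
by move=> cs cW kW; apply/smooth_germP => j; exact: smooth0_regular cs cW (kW j).
Qed.

End RegularFunctions.

(** * Lines as projectors *)

Section LineProjectors.
Local Open Scope classical_set_scope.
Local Open Scope ring_scope.
Context {R : realType}.

Lemma mulmx_tr_dot n (u w : 'rV[R]_n) : u *m w^T = (dot u w)%:M.
Proof.
apply/matrixP => i j; rewrite !ord1 !mxE eqxx mulr1n.
by apply: eq_bigr => l _; rewrite mxE.
Qed.

(** The orthogonal projector onto the line spanned by u, acting on row vectors from the right. *)
Definition proj_mx n (u : 'rV[R]_n) : 'M[R]_n := (dot u u)^-1 *: (u^T *m u).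

Lemma mul_proj_mx n (w u : 'rV[R]_n) :
  w *m proj_mx u = ((dot u u)^-1 * dot w u) *: u.
Proof. by rewrite -scalemxAr mulmxA mulmx_tr_dot mul_scalar_mx scalerA. Qed.

Lemma proj_mx_id n (u : 'rV[R]_n) : u != 0 -> u *m proj_mx u = u.
Proof. by move=> u0; rewrite mul_proj_mx mulVf ?scale1r// dot_self_eq0. Qed.

Lemma rowspace_proj_mx n (u w : 'rV[R]_n) : u != 0 ->
  rowspace (proj_mx u) w <-> exists a, w = a *: u.
Proof.
move=> u0; split=> [wu|[a ->]].
  by apply/sub_rVP; apply: submx_trans wu _; rewrite scalemx_sub ?submxMl.
apply: scalemx_sub; rewrite -{1}(proj_mx_id u0); exact: submxMl.
Qed.

Lemma line_projector_proj_mx n (u : 'rV[R]_n) : u != 0 -> line_projector (proj_mx u).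
Proof.
move=> u0; split.
- by rewrite /proj_mx linearZ/= trmx_mul trmxK.
- by rewrite {1}/proj_mx -scalemxAl -mulmxA proj_mx_id.
- apply/eqP; rewrite eqn_leq; apply/andP; split.
    apply: leq_trans (rank_leq_row u); apply: mxrankS.
    by rewrite scalemx_sub ?submxMl.
  rewrite lt0n mxrank_eq0; apply/eqP => P0; have := proj_mx_id u0.
  by rewrite P0 mulmx0 => /eqP; rewrite eq_sym (negbTE u0).
Qed.

(** The encoding of lines is faithful. Rank 1 gives M = v u with v a column, and transposing u M =
    u, with M symmetric, determines v. *)
Lemma line_projectorE n (M : 'M[R]_n) (u : 'rV[R]_n) :
  line_projector M -> rowspace M u -> u != 0 -> M = proj_mx u.
Proof.
move=> [Mt M2 M1] uM u0.
have uMu : u *m M = u by have /submxP[D ->] := uM; rewrite -mulmxA M2.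
have Mu : (M <= u)%MS.
  have := mxrank_leqif_sup uM; rewrite M1 rank_rV u0 => /leqifP.
  by case: ifP.
have /submxP[v Mv] := Mu.
have : M *m u^T = u^T by rewrite -{2}uMu trmx_mul Mt.
rewrite Mv -mulmxA mulmx_tr_dot mul_mx_scalar /proj_mx => <-.
by rewrite -scalemxAl scalerA mulVf ?scale1r// dot_self_eq0.
Qed.

Lemma line_projector_nz_row n (M : 'M[R]_n) : line_projector M ->
  rowspace M (nz_row M) /\ nz_row M != 0.
Proof.
move=> [_ _ M1]; split; first exact: nz_row_sub.
by rewrite nz_row_eq0 -mxrank_eq0 M1.
Qed.

(** The only quadrature required: coordinates along the constructed integral curves are kept
    polynomial. *)
Lemma poly_primitive (p : {poly R}) a : exists q, q^`() = p /\ q.[0] = a.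
Proof.
elim/poly_ind: p a => [|p b _] a; first by exists a%:P; rewrite derivC hornerC.
set P := p * 'X + b%:P.
exists (\poly_(i < (size P).+1) (if i is j.+1 then P`_j / j.+1%:R else a)); split.
  apply/polyP => i; rewrite coef_deriv coef_poly ltnS.
  case: ltnP => [iP|iP]; last by rewrite mul0rn nth_default.
  by rewrite -[LHS]mulr_natr divfK// pnatr_eq0.
by rewrite horner_coef0 coef_poly.
Qed.

End LineProjectors.

(** * Charts of a distribution *)

Section Charts.
Local Open Scope classical_set_scope.
Local Open Scope ring_scope.
Context {R : realType}.

(* F : coordinates whose differentials, the gradients G, coframe the rank 3     *)
(* distribution on the relatively open subset W; X is the dual frame.           *)
Record chart n (D : dspace (R := R) n) (F : 'I_3 -> 'rV[R]_n -> R)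
    (W : set 'rV[R]_n) (G X : 'I_3 -> 'rV[R]_n -> 'rV[R]_n) : Prop := Chart {
  chart_pts : W `<=` pts D;
  chart_open : forall c, smooth_curve_in (pts D) c -> W (c 0) ->
    \forall t \near (0 : R), W (c t);
  chart_F : forall i, regular W (F i);
  chart_G : forall i j, regular W (fun q => G i q 0 j);
  chart_grad : forall i, gradient W (F i) (G i);
  chart_X : forall i j, regular W (fun q => X i q 0 j);
  chart_dist : forall q w, W q ->
    (dist D q w <-> exists a : 'I_3 -> R, w = \sum_i a i *: X i q);
  chart_dual : forall q i j, W q -> dot (G i q) (X j q) = (i == j)%:R;
  chart_curve : forall q (P : 'I_3 -> {poly R}), W q -> (forall i, (P i).[0] = F i q) ->
    exists c, [/\ smooth_curve_in (pts D) c, c 0 = q &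
      \forall t \near (0 : R), velocity c t = \sum_i (P i)^`().[t] *: X i (c t) /\
        forall i, F i (c t) = (P i).[t]] }.

Section ChartTheory.
Variables (n : nat) (D : dspace (R := R) n) (F : 'I_3 -> 'rV[R]_n -> R).
Variables (W : set 'rV[R]_n) (G X : 'I_3 -> 'rV[R]_n -> 'rV[R]_n).
Hypothesis ch : chart D F W G X.

Lemma dot_frame q i (a : 'I_3 -> R) : W q -> dot (G i q) (\sum_j a j *: X j q) = a i.
Proof.
move=> Wq; rewrite dot_sumr (bigD1 i)//= (chart_dual ch)// eqxx mulr1 big1 ?addr0//.
by move=> j ji; rewrite (chart_dual ch)// eq_sym (negbTE ji) mulr0.
Qed.

Lemma chart_dist_coord q w : W q -> dist D q w -> w = \sum_i dot (G i q) w *: X i q.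
Proof.
move=> Wq /(chart_dist ch _ Wq)[a ->].
by apply: eq_bigr => i _; rewrite dot_frame.
Qed.

Lemma dist_lin q (a b : R) w w' : W q -> dist D q w -> dist D q w' ->
  dist D q (a *: w + b *: w').
Proof.
move=> Wq /(chart_dist ch _ Wq)[u ->] /(chart_dist ch _ Wq)[v ->].
apply/(chart_dist ch _ Wq); exists (fun i => a * u i + b * v i).
rewrite !scaler_sumr -big_split; apply: eq_bigr => i _ /=.
by rewrite scalerDl !scalerA.
Qed.

Lemma chart_linear_curve q (a : 'I_3 -> R) : W q ->
  exists c, [/\ smooth_curve_in (pts D) c, c 0 = q &
    \forall t \near (0 : R), velocity c t = \sum_i a i *: X i (c t) /\
        forall i, F i (c t) = F i q + a i * t].
Proof.
move=> Wq; have [|c [cD c0 cv]] := @chart_curve _ _ _ _ _ _ ch q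
    (fun i => (F i q)%:P + a i *: 'X) Wq.
  by move=> i; rewrite hornerD hornerC hornerZ hornerX mulr0 addr0.
exists c; split=> //; apply: filterS cv => t [-> Fc]; split.
  by apply: eq_bigr => i _; rewrite derivD derivC add0r derivZ derivX !hornerE.
by move=> i; rewrite Fc !hornerE.
Qed.

Lemma dist_tangent q w : W q -> dist D q w -> tangent (pts D) q w.
Proof.
move=> Wq /(chart_dist ch _ Wq)[a ->].
have [c [cD c0 cv]] := chart_linear_curve a Wq; exists c; split=> //.
by have [-> _] := nbhs_singleton cv; rewrite c0.
Qed.

Lemma chart_along c i : smooth_curve_in (pts D) c -> W (c 0) ->
  \forall t \near (0 : R), W (c t) /\
    is_derive t (1 : R) (fun s => F i (c s)) (dot (G i (c t)) (velocity c t)).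
Proof.
move=> cD Wc; have cW := chart_open ch cD Wc.
have [/smooth_germ_derivable cd _] := cD.
apply: filterS3 (near_join cW) cW cd => t tW Wt td; split=> //.
exact: (chart_grad ch).
Qed.

(** By the chain rule every curve with velocity w gives the same derivative, so the choice made by
    [xget] is harmless. *)
Lemma differentialE q i w : W q -> tangent (pts D) q w ->
  differential (pts D) (F i) q w = dot (G i q) w.
Proof.
move=> Wq qw; rewrite /differential; case: (xgetPex (fun=> q) qw).
set c := xget _ _ => cD c0 <-; have Wc : W (c 0) by rewrite c0.
have [_ /is_derive1E] := nbhs_singleton (chart_along i cD Wc).
by rewrite c0.
Qed.

End ChartTheory.
End Charts.

(** * Prolongation of a chart *)

Section ChartProlongation.
Local Open Scope classical_set_scope.
Local Open Scope ring_scope.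
Context {R : realType}.

(** One Kumpera-Rubin step when [F a] is selected: index 0 is the new f, and [lift a j] runs through
    the two remaining functions in their order, giving the new u and v. *)
Definition prolong_coord n (Z : set 'rV[R]_n) (F : 'I_3 -> 'rV[R]_n -> R) (a : 'I_3)
    (i : 'I_3) : 'rV[R]_(n + n * n) -> R :=
  if unlift ord0 i is Some j then fiber_coord Z (F (lift a j)) (F a)
  else F a \o @base R n.

Definition prolong_dom n (D : dspace (R := R) n) (F : 'I_3 -> 'rV[R]_n -> R)
    (W : set 'rV[R]_n) (a : 'I_3) : set 'rV[R]_(n + n * n) :=
  [set q | [/\ proj_bundle D q, W (base q)
             & nonvanishing (pts D) (F a) (base q) (line q)]].

Implicit Types (n : nat).

Lemma base_row_mx n (b : 'rV[R]_n) (v : 'rV[R]_(n * n)) : base (row_mx b v) = b.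
Proof. exact: row_mxKl. Qed.

Lemma line_row_mx n (b : 'rV[R]_n) (M : 'M[R]_n) : line_mx (row_mx b (mxvec M)) = M.
Proof. by rewrite /line_mx row_mxKr mxvecK. Qed.

Lemma row_mx_base_line n (q : 'rV[R]_(n + n * n)) :
  row_mx (base q) (mxvec (line_mx q)) = q.
Proof. by rewrite /line_mx vec_mxK hsubmxK. Qed.

Lemma base_coordE n (c : R -> 'rV[R]_(n + n * n)) j :
  (fun s => base (c s) 0 j) = (fun s => c s 0 (lshift (n * n) j)).
Proof. by apply/funext => s; rewrite mxE. Qed.

Lemma velocity_base n (c : R -> 'rV[R]_(n + n * n)) t :
  velocity (fun s => base (c s)) t = base (velocity c t).
Proof. by apply/rowP => j; rewrite [LHS]mxE base_coordE !mxE. Qed.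

Lemma curve_derivable_base n (c : R -> 'rV[R]_(n + n * n)) t :
  curve_derivable c t -> curve_derivable (fun s => base (c s)) t.
Proof. by move=> cd j; rewrite base_coordE; exact: cd. Qed.

Lemma smooth_germ_base n (c : R -> 'rV[R]_(n + n * n)) :
  smooth_germ c -> smooth_germ (fun s => base (c s)).
Proof.
by move=> /smooth_germP cs; apply/smooth_germP => j; rewrite base_coordE; exact: cs.
Qed.

Lemma smooth_curve_base n (D : dspace (R := R) n) (c : R -> 'rV[R]_(n + n * n)) :
  smooth_curve_in (proj_bundle D) c -> smooth_curve_in (pts D) (fun s => base (c s)).
Proof.
move=> [cs cD]; split; first exact: smooth_germ_base.
by apply: filterS cD => t [].
Qed.

Lemma regular_base n (W : set 'rV[R]_n) (W' : set 'rV[R]_(n + n * n)) g :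
  (forall q, W' q -> W (base q)) -> regular W g -> regular W' (fun q => g (base q)).
Proof.
move=> WW; apply: regular_comp => // j.
apply: (regular_ext (g := fun q => q 0 (lshift _ j))); last exact: regular_coord.
by move=> q _; rewrite mxE.
Qed.

Section Step.
Variables (n : nat) (D : dspace (R := R) n) (F : 'I_3 -> 'rV[R]_n -> R).
Variables (W : set 'rV[R]_n) (G X : 'I_3 -> 'rV[R]_n -> 'rV[R]_n).
Hypothesis ch : chart D F W G X.
Variable a : 'I_3.

Local Notation W' := (prolong_dom D F W a).
Local Notation F' := (prolong_coord (pts D) F a).

Definition ratio i (q : 'rV[R]_(n + n * n)) : R := fiber_coord (pts D) (F i) (F a) q.
(** On [W'], the generator of the line normalised by dF_a = 1. *)
Definition spanner (q : 'rV[R]_(n + n * n)) : 'rV[R]_n :=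
  \sum_i ratio i q *: X i (base q).

Lemma line_dist q u : proj_bundle D q -> line q u -> dist D (base q) u.
Proof. by move=> [_ _]; apply. Qed.

Lemma line_differential q i u : proj_bundle D q -> W (base q) -> line q u ->
  differential (pts D) (F i) (base q) u = dot (G i (base q)) u.
Proof.
move=> qD qW qu; apply: (differentialE ch) => //.
by apply: (dist_tangent ch) => //; exact: line_dist.
Qed.

Lemma line_mul (q : 'rV[R]_(n + n * n)) u :
  line_projector (line_mx q) -> u != 0 -> line q u ->
  forall w, line q w <-> exists x, w = x *: u.
Proof.
move=> qM u0 qu w; rewrite /line (line_projectorE qM qu u0).
exact: rowspace_proj_mx.
Qed.

Lemma ratioE q i u : proj_bundle D q -> W (base q) -> line q u -> u != 0 ->
  ratio i q = dot (G i (base q)) u / dot (G a (base q)) u.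
Proof.
move=> qD qW qu u0; have [_ qM _] := qD; have [qv v0] := line_projector_nz_row qM.
have [x vE] := (line_mul qM u0 qu _).1 qv.
rewrite /ratio /fiber_coord !line_differential// vE !dotZr invfM mulrACA divff ?mul1r//.
by apply: contraNneq v0 => x0; rewrite vE x0 scale0r.
Qed.

Lemma dot_line_neq0 q u : W' q -> line q u -> u != 0 -> dot (G a (base q)) u != 0.
Proof.
move=> [qD qW [w qw]]; rewrite line_differential// => w0 qu u0.
have [_ qM _] := qD; move: w0; have [x ->] := (line_mul qM u0 qu _).1 qw; rewrite dotZr.
by apply: contraNneq => ->; rewrite mulr0.
Qed.

Lemma ratio_choice q : W' q -> ratio a q = 1.
Proof.
move=> qW'; have [qD qW _] := qW'; have [_ qM _] := qD.
have [qv v0] := line_projector_nz_row qM.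
by rewrite (ratioE _ qD qW qv v0) divff// dot_line_neq0.
Qed.

Lemma dot_spanner q i : W (base q) -> dot (G i (base q)) (spanner q) = ratio i q.
Proof. by move=> qW; rewrite (dot_frame ch). Qed.

Lemma line_spanner q : W' q -> line q (spanner q) /\ spanner q != 0.
Proof.
move=> qW'; have [qD qW _] := qW'; have [_ qM _] := qD; split; last first.
  apply/eqP => s0; have := dot_spanner a qW.
  by rewrite ratio_choice// s0 dot0r => /eqP; rewrite eq_sym oner_eq0.
have [qv v0] := line_projector_nz_row qM.
have vE := chart_dist_coord ch qW (line_dist qD qv).
apply/(line_mul qM v0 qv); exists (dot (G a (base q)) (nz_row (line_mx q)))^-1.
rewrite {2}vE scaler_sumr; apply: eq_bigr => i _.
by rewrite scalerA mulrC (ratioE _ qD qW qv v0).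
Qed.

Lemma line_mx_spanner q : W' q -> line_mx q = proj_mx (spanner q).
Proof.
move=> qW'; have [qs s0] := line_spanner qW'; have [[_ qM _] _ _] := qW'.
exact: line_projectorE.
Qed.

Lemma lineP q w : W' q -> (line q w <-> exists x, w = x *: spanner q).
Proof.
move=> qW'; have [qs s0] := line_spanner qW'; have [[_ qM _] _ _] := qW'.
exact: line_mul.
Qed.

(** The gradient of [F a] projected onto the line. Unlike the vector [nz_row] it depends regularly
    on q, even where dF_a vanishes on the line, and on [W'] it is a nonzero multiple of [spanner].
    It yields both the regularity of the ratios and the openness of [W']. *)
Definition line_row (q : 'rV[R]_(n + n * n)) : 'rV[R]_n := G a (base q) *m line_mx q.

Lemma line_rowE q : W' q ->
  line_row q = (dot (spanner q) (spanner q))^-1 *: spanner q.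
Proof.
move=> qW'; have [_ qW _] := qW'.
by rewrite /line_row line_mx_spanner// mul_proj_mx dot_spanner// ratio_choice// mulr1.
Qed.

Lemma dot_line_row q i : W' q ->
  dot (G i (base q)) (line_row q) = (dot (spanner q) (spanner q))^-1 * ratio i q.
Proof.
by move=> qW'; have [_ qW _] := qW'; rewrite line_rowE// dotZr dot_spanner.
Qed.

Lemma dot_spanner_neq0 q : W' q -> dot (spanner q) (spanner q) != 0.
Proof. by move=> qW'; rewrite dot_self_eq0; have [] := line_spanner qW'. Qed.

Lemma regular_line_row (U : set 'rV[R]_(n + n * n)) i :
  (forall q, U q -> W (base q)) ->
  regular U (fun q => dot (G i (base q)) (line_row q)).
Proof.
move=> UW; apply: regular_dot => j; first exact: regular_base (chart_G ch i j).
apply: (regular_ext (g := fun q =>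
  \sum_l G a (base q) 0 l * q 0 (rshift n (mxvec_index l j)))).
  by move=> q _; rewrite mxE; apply: eq_bigr => l _; rewrite !mxE.
apply: regular_sum => l; apply: regularM; last exact: regular_coord.
exact: regular_base (chart_G ch a l).
Qed.

Lemma regular_ratio i : regular W' (ratio i).
Proof.
apply: (regular_ext (g := fun q => dot (G i (base q)) (line_row q) *
    (dot (G a (base q)) (line_row q))^-1)) => [q qW'|].
  rewrite !dot_line_row// ratio_choice// mulr1 mulrAC mulfV ?mul1r//.
  by rewrite invr_eq0 dot_spanner_neq0.
apply: regularM; first by apply: regular_line_row => q [].
apply: regularV; last by apply: regular_line_row => q [].
move=> q qW'; rewrite dot_line_row// ratio_choice// mulr1.
by rewrite invr_eq0 dot_spanner_neq0.
Qed.

Lemma regular_spanner j : regular W' (fun q => spanner q 0 j).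
Proof.
apply: (regular_ext (g := fun q => \sum_i ratio i q * X i (base q) 0 j)).
  by move=> q _; rewrite /spanner summxE; apply: eq_bigr => i _; rewrite mxE.
apply: regular_sum => i; apply: regularM; first exact: regular_ratio.
by apply: regular_base (chart_X ch i j) => q [].
Qed.

Lemma prolong_coord0 q : F' ord0 q = F a (base q).
Proof. by rewrite /prolong_coord unlift_none. Qed.

Lemma prolong_coordS q j : F' (lift ord0 j) q = ratio (lift a j) q.
Proof. by rewrite /prolong_coord liftK. Qed.

Lemma regular_prolong_coord i : regular W' (F' i).
Proof.
case: (unliftP ord0 i) => [j|] ->.
  by apply: regular_ext (regular_ratio (lift a j)) => q _; rewrite prolong_coordS.
apply: (regular_ext (g := fun q => F a (base q))) => [q _|].
  by rewrite prolong_coord0.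
by apply: regular_base (chart_F ch a) => q [].
Qed.

(* A point of the prolongation is rebuilt from its base point and from the     *)
(* ratios of the coordinate differentials on its line.                         *)
Definition coords_vec (x : 'rV[R]_(n + 3)) : 'rV[R]_n :=
  \sum_i rsubmx x 0 i *: X i (lsubmx x).
Definition coords_pt (x : 'rV[R]_(n + 3)) : 'rV[R]_(n + n * n) :=
  row_mx (lsubmx x) (mxvec (proj_mx (coords_vec x))).
Definition pt_coords (q : 'rV[R]_(n + n * n)) : 'rV[R]_(n + 3) :=
  row_mx (base q) (\row_i ratio i q).
Definition coords_dom : set 'rV[R]_(n + 3) :=
  [set x | W (lsubmx x) /\ coords_vec x != 0].

Lemma coords_vec_pt q : coords_vec (pt_coords q) = spanner q.
Proof.
rewrite /coords_vec row_mxKl row_mxKr; apply: eq_bigr => i _; by rewrite mxE.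
Qed.

Lemma pt_coordsK q : W' q -> coords_pt (pt_coords q) = q.
Proof.
move=> qW'; rewrite /coords_pt coords_vec_pt row_mxKl -line_mx_spanner//.
exact: row_mx_base_line.
Qed.

Lemma pt_coords_dom q : W' q -> coords_dom (pt_coords q).
Proof.
move=> qW'; split; first by rewrite row_mxKl; have [] := qW'.
by rewrite coords_vec_pt; have [] := line_spanner qW'.
Qed.

Lemma regular_coords_vec j : regular coords_dom (fun x => coords_vec x 0 j).
Proof.
apply: (regular_ext (g := fun x =>
    \sum_i x 0 (rshift n i) * X i (lsubmx x) 0 j)) => [x _|].
  by rewrite summxE; apply: eq_bigr => i _; rewrite !mxE.
apply: regular_sum => i; apply: regularM; first exact: regular_coord.
apply: (regular_comp _ _ (chart_X ch i j)) => [l|x []//].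
apply: (regular_ext (g := fun x => x 0 (lshift 3 l))) => [x _|]; first by rewrite mxE.
exact: regular_coord.
Qed.

Lemma regular_coords_pt J : regular coords_dom (fun x => coords_pt x 0 J).
Proof.
case: (split_ordP J) => j ->.
  apply: (regular_ext (g := fun x => x 0 (lshift 3 j))) => [x _|].
    by rewrite row_mxEl mxE.
  exact: regular_coord.
case/mxvec_indexP: j => l m.
apply: (regular_ext (g := fun x => (dot (coords_vec x) (coords_vec x))^-1 *
    (coords_vec x 0 l * coords_vec x 0 m))) => [x _|].
  by rewrite row_mxEr mxvecE !mxE big_ord1 !mxE.
apply: regularM; last by apply: regularM; exact: regular_coords_vec.
apply: regularV; first by move=> x [_]; rewrite dot_self_eq0.
by apply: regular_dot => j; exact: regular_coords_vec.
Qed.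

Lemma regular_pt_coords J : regular W' (fun q => pt_coords q 0 J).
Proof.
case: (split_ordP J) => j ->.
  apply: (regular_ext (g := fun q => q 0 (lshift _ j))) => [q _|].
    by rewrite row_mxEl mxE.
  exact: regular_coord.
apply: regular_ext (regular_ratio j) => q _.
by rewrite row_mxEr mxE.
Qed.

End Step.
End ChartProlongation.

(** * Frame and integral curves of the prolonged distribution *)

Section ChartProlongationFrame.
Local Open Scope classical_set_scope.
Local Open Scope ring_scope.
Context {R : realType}.
Variables (n : nat) (D : dspace (R := R) n) (F : 'I_3 -> 'rV[R]_n -> R).
Variables (W : set 'rV[R]_n) (G X : 'I_3 -> 'rV[R]_n -> 'rV[R]_n).
Hypothesis ch : chart D F W G X.
Variable a : 'I_3.

Local Notation W' := (prolong_dom D F W a).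
Local Notation F' := (prolong_coord (pts D) F a).
Local Notation rho := (ratio D F a).
Local Notation N := (spanner D F X a).
Local Notation kappa := (pt_coords D F a).

Lemma sum_lift3 (V : nmodType) (i0 : 'I_3) (g : 'I_3 -> V) :
  \sum_i g i = g i0 + \sum_(j < 2) g (lift i0 j).
Proof. by rewrite (bigD1_ord i0). Qed.

(** The frame dual to the new coordinates, written in [pt_coords]: index 0 moves the base point
    along the line with the ratios frozen, the other two indices move one ratio with the base point
    frozen. *)
Definition frame_coords (i : 'I_3) (q : 'rV[R]_(n + n * n)) : 'rV[R]_(n + 3) :=
  if unlift ord0 i is Some j then row_mx 0 (delta_mx 0 (lift a j))
  else row_mx (N q) 0.

Lemma regular_frame_coords i J : regular W' (fun q => frame_coords i q 0 J).
Proof.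
rewrite /frame_coords; case: (unliftP ord0 i) => [j|] _.
  exact: (regular_cst W' (row_mx 0 (delta_mx 0 (lift a j)) 0 J)).
case: (split_ordP J) => j ->.
  by apply: regular_ext (regular_spanner ch a j) => q _; rewrite row_mxEl.
apply: (regular_ext (g := fun=> 0)) => [q _|]; last exact: regular_cst.
by rewrite row_mxEr mxE.
Qed.

Lemma velocity_pt_coords c t x : curve_derivable c t ->
  (\forall s \near t, W' (c s)) ->
  velocity (fun s => base (c s)) t = x *: N (c t) ->
  velocity (fun s => kappa (c s)) t =
    x *: frame_coords ord0 (c t) +
    \sum_(j < 2) derive1 (fun s => F' (lift ord0 j) (c s)) t *:
      frame_coords (lift ord0 j) (c t).
Proof.
move=> cd cW bv.
have EF j : frame_coords (lift ord0 j) (c t) = row_mx 0 (delta_mx 0 (lift a j)).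
  by rewrite /frame_coords liftK.
have E0 : frame_coords ord0 (c t) = row_mx (N (c t)) 0.
  by rewrite /frame_coords unlift_none.
rewrite E0; under eq_bigr do rewrite EF; apply/rowP => J.
case: (split_ordP J) => j ->.
  rewrite [LHS]mxE [RHS]mxE summxE [X in _ = X + _]mxE row_mxEl.
  rewrite big1 ?addr0 => [|i _]; last by rewrite mxE row_mxEl mxE mulr0.
  have /rowP/(_ j) := bv; rewrite !mxE => <-.
  by congr (derive1 _ t); apply/funext => s; rewrite row_mxEl.
rewrite [LHS]mxE [RHS]mxE summxE [X in _ = X + _]mxE row_mxEr mxE mulr0 add0r.
have -> : (fun s => kappa (c s) 0 (rshift n j)) = (fun s => rho j (c s)).
  by apply/funext => s; rewrite row_mxEr mxE.
case: (unliftP a j) => [i|] ->.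
  rewrite (bigD1 i)//= big1 ?addr0 => [|l li].
    rewrite mxE row_mxEr mxE !eqxx mulr1; congr (derive1 _ t).
    by apply/funext => s; rewrite prolong_coordS.
  by rewrite mxE row_mxEr mxE (inj_eq lift_inj) eq_sym (negbTE li) andbF mulr0.
(* The ratio of index a is constantly 1 on [W'], so it contributes no velocity. *)
rewrite big1 => [|l _].
  rewrite (@derive1_near _ _ (fun=> 1)) ?derive1_cst//.
  by apply: filterS cW => s /(ratio_choice ch).
by rewrite mxE row_mxEr mxE (negbTE (neq_lift _ _)) andbF mulr0.
Qed.

Lemma derivable_pt_coords c t : curve_derivable c t ->
  (\forall s \near t, W' (c s)) -> curve_derivable (fun s => kappa (c s)) t.
Proof.
move=> cd cW J; have [K [_ Kg]] := regular_gradient (regular_pt_coords ch a J).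
by have [] := Kg c t cd cW.
Qed.

Lemma velocity_prolong_coord0 c t x : curve_derivable c t ->
  (\forall s \near t, W' (c s)) ->
  velocity (fun s => base (c s)) t = x *: N (c t) ->
  derive1 (fun s => F' ord0 (c s)) t = x.
Proof.
move=> cd cW bv; have Wt := nbhs_singleton cW; have [_ bW _] := Wt.
have bWn : \forall s \near t, W (base (c s)) by apply: filterS cW => s [].
have := is_derive1E (chart_grad ch a (curve_derivable_base cd) bWn).
rewrite bv dotZr (dot_spanner ch)// (ratio_choice ch)// mulr1 => <-.
by congr (derive1 _ t); apply/funext => s; rewrite prolong_coord0.
Qed.

(** Near t the curve is [coords_pt] of its own coordinates, so the chain rule pushes the coordinate
    velocity, a combination of [frame_coords], forward by K. *)
Lemma velocity_prolong (K : 'I_(n + n * n) -> 'rV[R]_(n + 3) -> 'rV[R]_(n + 3)) c t :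
  (forall J, gradient (coords_dom W X) (fun x => coords_pt X x 0 J) (K J)) ->
  curve_derivable c t -> (\forall s \near t, W' (c s)) ->
  line (c t) (base (velocity c t)) ->
  velocity c t = \sum_i derive1 (fun s => F' i (c s)) t *:
    \row_J dot (K J (kappa (c t))) (frame_coords i (c t)).
Proof.
move=> Kg cd cW lc; have Wt := nbhs_singleton cW.
have [x bv] := (lineP ch _ Wt).1 lc; rewrite -velocity_base in bv.
have E : velocity (fun s => coords_pt X (kappa (c s))) t = velocity c t.
  by apply: velocity_near; apply: filterS cW => s /(pt_coordsK ch).
have cWd : \forall s \near t, coords_dom W X (kappa (c s)).
  by apply: filterS cW => s /(pt_coords_dom ch).
rewrite -E; apply/rowP => J; rewrite mxE.
have := is_derive1E (Kg J _ t (derivable_pt_coords cd cW) cWd).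
move=> ->; rewrite (velocity_pt_coords cd cW bv) (sum_lift3 ord0) dotDr dotZr dot_sumr.
rewrite (velocity_prolong_coord0 cd cW bv) !mxE summxE; congr (_ + _).
by apply: eq_bigr => j _; rewrite !mxE.
Qed.

Definition chosen_ratios (P : 'I_3 -> {poly R}) (t : R) : 'rV[R]_3 :=
  \row_i (if unlift a i is Some j then (P (lift ord0 j)).[t] else 1).

(** The line over [b t] has the prescribed ratios; that it is tangent to b comes only from the
    choice of b in [prolong_curve]. *)
Definition lifted_curve (b : R -> 'rV[R]_n) (P : 'I_3 -> {poly R}) (t : R) :=
  coords_pt X (row_mx (b t) (chosen_ratios P t)).

Lemma lifted_curve_vec b P t : W (b t) ->
  let u := coords_vec X (row_mx (b t) (chosen_ratios P t)) in
  [/\ u = \sum_i chosen_ratios P t 0 i *: X i (b t),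
      forall i, dot (G i (b t)) u = chosen_ratios P t 0 i & u != 0].
Proof.
move=> Wb u; have uE : u = \sum_i chosen_ratios P t 0 i *: X i (b t).
  by rewrite /u /coords_vec row_mxKl row_mxKr.
have du i : dot (G i (b t)) u = chosen_ratios P t 0 i by rewrite uE (dot_frame ch).
split=> //; apply: contraTneq (oner_neq0 R) => u0.
have := du a; rewrite u0 dot0r mxE unlift_none => <-.
by rewrite eqxx.
Qed.

Lemma lifted_curve_dom b P t : pts D (b t) -> W (b t) ->
  W' (lifted_curve b P t) /\
  forall i, rho i (lifted_curve b P t) = chosen_ratios P t 0 i.
Proof.
move=> Db Wb; have [uE du u0] := lifted_curve_vec P Wb.
set u := coords_vec _ _ in uE du u0.
have bE : base (lifted_curve b P t) = b t by rewrite base_row_mx row_mxKl.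
have lE : line_mx (lifted_curve b P t) = proj_mx u by rewrite line_row_mx.
have lu : line (lifted_curve b P t) u.
  by rewrite /line lE; apply/(rowspace_proj_mx _ u0); exists 1; rewrite scale1r.
have qD : proj_bundle D (lifted_curve b P t).
  split; [by rewrite bE|by rewrite lE; exact: line_projector_proj_mx|].
  rewrite /line lE bE => w /(rowspace_proj_mx _ u0)[x ->].
  apply/(chart_dist ch _ Wb); exists (fun i => x * chosen_ratios P t 0 i).
  by rewrite uE scaler_sumr; apply: eq_bigr => i _; rewrite scalerA.
have ca : chosen_ratios P t 0 a = 1 by rewrite mxE unlift_none.
split; last first.
  move=> i; by rewrite (ratioE ch a i qD _ lu u0) bE// !du ca divr1.
split=> //; rewrite ?bE//; exists u => //.
by rewrite -bE (line_differential ch)// bE// du ca oner_neq0.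
Qed.

Lemma lifted_curve_smooth b P : smooth_germ b ->
  (\forall t \near (0 : R), W (b t)) -> smooth_germ (lifted_curve b P).
Proof.
move=> bs bW; apply: (smooth_germ_regular _ _ (regular_coords_pt ch)).
  apply/smooth_germP => J; case: (split_ordP J) => j ->.
    have /smooth_germP/(_ j) := bs; congr smooth0.
    by apply/funext => s; rewrite row_mxEl.
  have : smooth0 (fun t => chosen_ratios P t 0 j).
    case: (unliftP a j) => [i|] ->.
      have := smooth0_horner (P (lift ord0 i)); congr smooth0.
      by apply/funext => s; rewrite mxE liftK.
    have := @smooth0_cst R 1; congr smooth0.
    by apply/funext => s; rewrite mxE unlift_none.
  by congr smooth0; apply/funext => s; rewrite row_mxEr.
apply: filterS bW => t Wb; split; first by rewrite row_mxKl.
by have [] := lifted_curve_vec P Wb.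
Qed.

(* Integral curves of the prolongation are found by quadrature from their top  *)
(* coordinates: dF_(lift a j) = P_(1+j) dP_0 gives the lower ones.             *)
Lemma prolong_curve (K : 'I_(n + n * n) -> 'rV[R]_(n + 3) -> 'rV[R]_(n + 3))
    q (P : 'I_3 -> {poly R}) :
  (forall J, gradient (coords_dom W X) (fun x => coords_pt X x 0 J) (K J)) ->
  W' q -> (forall i, (P i).[0] = F' i q) ->
  exists c, [/\ smooth_curve_in (proj_bundle D) c, c 0 = q &
    \forall t \near (0 : R), [/\ velocity c t = \sum_i (P i)^`().[t] *:
         \row_J dot (K J (kappa (c t))) (frame_coords i (c t)),
       forall i, F' i (c t) = (P i).[t] & line (c t) (base (velocity c t))]].
Proof.
move=> Kg qW' Pq; have [qD qW _] := qW'.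
have [Q Qd Q0] : exists2 Q : 'I_3 -> {poly R},
    forall i, (Q i)^`() = (if unlift a i is Some j then P (lift ord0 j) else 1) *
                        (P ord0)^`() &
    forall i, (Q i).[0] = F i (base q) /\ (i = a -> Q i = P ord0).
  have H i : exists Qi : {poly R},
      [/\ Qi^`() = (if unlift a i is Some j then P (lift ord0 j) else 1) *
                        (P ord0)^`(),
         Qi.[0] = F i (base q) & (i = a -> Qi = P ord0)].
    case: (unliftP a i) => [j|] ->.
      have [Qi [? ?]] := poly_primitive (P (lift ord0 j) * (P ord0)^`())
        (F (lift a j) (base q)).
      by exists Qi; split=> // /eqP; rewrite eq_sym (negbTE (neq_lift _ _)).
    by exists (P ord0); rewrite mul1r; split=> //; rewrite Pq prolong_coord0.
  have [Q HQ] := choice H; exists Q => i; have [] := HQ i => //.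
have [b [bD b0 bv]] := chart_curve ch qW (fun i => (Q0 i).1).
have bW : \forall t \near (0 : R), W (b t).
  by apply: (chart_open ch bD); rewrite b0.
have [bs bDn] := bD.
have cs := lifted_curve_smooth P bs bW.
set c := lifted_curve b P in cs *.
have cW' : \forall t \near (0 : R), W' (c t) /\
    forall i, rho i (c t) = chosen_ratios P t 0 i.
  by apply: filterS2 bDn bW => t; exact: lifted_curve_dom.
have c0 : c 0 = q.
  rewrite /c /lifted_curve b0 -[RHS](pt_coordsK ch qW'); congr (coords_pt X (row_mx _ _)).
  apply/rowP => i; rewrite !mxE; case: (unliftP a i) => [j|] ->.
    by rewrite Pq prolong_coordS.
  by rewrite (ratio_choice ch).
have bE t : base (c t) = b t by rewrite base_row_mx row_mxKl.
have cF : \forall t \near (0 : R), forall i, F' i (c t) = (P i).[t].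
  apply: filterS2 cW' bv => t [_ cr] [_ bF] i.
  case: (unliftP ord0 i) => [j|] ->.
    by rewrite prolong_coordS cr mxE liftK.
  by rewrite prolong_coord0 bE bF (Q0 a).2.
(* By the choice of Q, the frame components of b' are the ratios times the derivative of [P ord0],
   so b' is a multiple of the spanner. *)
have cl : \forall t \near (0 : R), line (c t) (base (velocity c t)).
  apply: filterS3 cW' bv bW => t [tW' cr] [bv' _] Wb.
  apply/(lineP ch _ tW'); exists (P ord0)^`().[t].
  rewrite -velocity_base (_ : (fun s => base (c s)) = b); last exact/funext.
  rewrite bv' scaler_sumr; apply: eq_bigr => i _.
  rewrite scalerA cr mxE bE Qd hornerM mulrC; congr (_ * _ *: _).
  by case: (unlift a i) => [j//|]; rewrite hornerE.
exists c; split=> //; first by split=> //; apply: filterS cW' => t [[]].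
have cWn : \forall t \near (0 : R), W' (c t) by apply: filterS cW' => t [].
have cd := smooth_germ_derivable cs.
apply: filterS (filterI (filterI (near_join cF) (near_join cWn)) (filterI cd cl)).
move=> t [[tF tW] [td tl]]; split=> //; last exact: nbhs_singleton tF.
rewrite (velocity_prolong Kg td tW tl); apply: eq_bigr => i _; congr (_ *: _).
rewrite derivE; apply: derive1_near; apply: filterS tF => s; exact.
Qed.

End ChartProlongationFrame.

(** * Charts pass to the Cartan prolongation *)

Section ChartProlongationTheorem.
Local Open Scope classical_set_scope.
Local Open Scope ring_scope.
Context {R : realType}.
Variables (n : nat) (D : dspace (R := R) n) (F : 'I_3 -> 'rV[R]_n -> R).
Variables (W : set 'rV[R]_n) (G X : 'I_3 -> 'rV[R]_n -> 'rV[R]_n).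
Hypothesis ch : chart D F W G X.
Variable a : 'I_3.

Local Notation W' := (prolong_dom D F W a).
Local Notation F' := (prolong_coord (pts D) F a).

(** That dF_a does not vanish on the line is witnessed by the continuous function dF_a([line_row]),
    nonzero at time 0. *)
Lemma prolong_dom_open c : smooth_curve_in (proj_bundle D) c -> W' (c 0) ->
  \forall t \near (0 : R), W' (c t).
Proof.
move=> cD W'0; have [cs cDn] := cD; have [_ W0 _] := W'0.
have bW := chart_open ch (smooth_curve_base cD) W0.
have /smooth0_continuous/near_neq0 := smooth0_regular cs bW
  (regular_line_row ch a (U := fun q => W (base q)) a (fun _ => id)).
have r0 : dot (G a (base (c 0))) (line_row G a (c 0)) != 0.
  rewrite (dot_line_row ch)// (ratio_choice ch)// mulr1 invr_eq0.
  exact: (dot_spanner_neq0 ch).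
move=> /(_ r0) rn; apply: filterS3 cDn bW rn => t Dt Wt rt; split=> //.
have lt : line (c t) (line_row G a (c t)) by exact: submxMl.
by exists (line_row G a (c t)) => //; rewrite (line_differential ch).
Qed.

Theorem chart_prolong :
  exists G' X', chart (prolongation D) F' W' G' X'.
Proof.
have [K HK] := choice (fun J => regular_gradient (regular_coords_pt ch J)).
have Kg J := (HK J).2.
have [G' HG'] := choice (fun i => regular_gradient (regular_prolong_coord ch a i)).
pose X' i q := \row_J dot (K J (pt_coords D F a q)) (frame_coords D F X a i q).
(* Curves along which the new coordinates are affine in t. They realise every combination of the
   frame as a tangent vector, and for x a basis vector they give duality. *)
have lin q (x : 'I_3 -> R) : W' q -> exists c,
    [/\ smooth_curve_in (proj_bundle D) c, c 0 = q, \forall t \near (0 : R), W' (c t),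
      \forall t \near (0 : R), forall i, F' i (c t) = F' i q + x i * t &
      velocity c 0 = \sum_i x i *: X' i q /\ line q (base (velocity c 0))].
  move=> qW'; have [|c [cD c0 cv]] :=
      prolong_curve ch (P := fun i => (F' i q)%:P + x i *: 'X) Kg qW'.
    by move=> i; rewrite hornerD hornerC hornerZ hornerX mulr0 addr0.
  exists c; split=> //; first by apply: prolong_dom_open; rewrite // c0.
    by apply: filterS cv => t [_ cF _] i; rewrite cF !hornerE.
  have [-> _] := nbhs_singleton cv; rewrite c0; split=> //.
  by apply: eq_bigr => i _; rewrite derivD derivC add0r derivZ derivX !hornerE.
exists G', X'; split.
- by move=> q [qD _ _]; exact: qD.
- exact: prolong_dom_open.
- exact: (regular_prolong_coord ch a).
- by move=> i; exact: (HG' i).1.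
- by move=> i; exact: (HG' i).2.
- move=> i J; apply: (regular_ext (g := fun q =>
      dot (K J (pt_coords D F a q)) (frame_coords D F X a i q))) => [q _|].
    by rewrite mxE.
  apply: regular_dot => j; last exact: (regular_frame_coords ch).
  apply: (regular_comp (k := pt_coords D F a) _ _ ((HK J).1 j)).
    exact: (regular_pt_coords ch).
  exact: (pt_coords_dom ch).
- move=> q w qW'; split=> [[[c [cD c0 cw]] lw]|[x ->]].
    exists (fun i => derive1 (fun s => F' i (c s)) 0).
    have cW : \forall s \near (0 : R), W' (c s).
      by apply: prolong_dom_open => //; rewrite c0.
    have cd := nbhs_singleton (smooth_germ_derivable cD.1).
    rewrite -cw (velocity_prolong ch Kg cd cW) c0// cw//.
  have [c [cD c0 _ _ [cv lw]]] := lin q x qW'.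
  by split; [exists c|rewrite -cv].
- move=> q i j qW'; have [c [cD c0 cW cF [cv _]]] := lin q (fun i => (i == j)%:R) qW'.
  have cd := nbhs_singleton (smooth_germ_derivable cD.1).
  have := is_derive1E ((HG' i).2 c 0 cd cW).
  rewrite c0 cv (bigD1 j)//= big1 ?addr0 => [|l lj].
    rewrite eqxx scale1r => <-.
    rewrite (@derive1_near _ _ (horner ((F' i q)%:P + (i == j)%:R *: 'X))).
      rewrite (is_derive1E (is_derive_poly _ 0)) derivD derivC add0r derivZ derivX.
      by rewrite hornerZ hornerC mulr1.
    by apply: filterS cF => t ->; rewrite hornerD hornerZ hornerX hornerC.
  by rewrite (negbTE lj) scale0r.
- move=> q P qW' Pq; have [c [cD c0 cv]] := prolong_curve ch Kg qW' Pq.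
  exists c; split=> //; apply: filterS cv => t [-> cF _]; split=> //.
Qed.

End ChartProlongationTheorem.

(** * The Monster tower in Kumpera-Rubin coordinates *)

Section Tower.
Local Open Scope classical_set_scope.
Local Open Scope ring_scope.
Context {R : realType}.

Local Notation P k := (pts (monster (R := R) k)).
Local Notation Delta k := (dist (monster (R := R) k)).

Definition kr_fun n (C : kr_coords (R := R) n) (i : 'I_3) : 'rV[R]_n -> R :=
  match val i with 0 => kr_f C | 1 => kr_u C | _ => kr_v C end.

Definition coord k (p : 'rV[R]_(amb_dim k)) : 'I_3 -> 'rV[R]_(amb_dim k) -> R :=
  kr_fun (kr p).

(** Indices of u and v, written with [lift] to match the case analysis of [prolong_coord] and
    [crit]. *)
Definition o1 : 'I_3 := lift ord0 (@ord0 1).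
Definition o2 : 'I_3 := lift ord0 (@ord_max 1).

(* The index of the coordinate of level k that becomes f_k+1. *)
Definition kr_index k (p : 'rV[R]_(amb_dim k.+1)) : 'I_3 :=
  if `[< nonvanishing (P k) (coord (base p) ord0) (base p) (line p) >] then ord0
  else if `[< nonvanishing (P k) (coord (base p) o1) (base p) (line p) >] then o1
  else o2.

Lemma coord_prolong k (p : 'rV[R]_(amb_dim k.+1)) :
  coord p = prolong_coord (P k) (coord (base p)) (kr_index p).
Proof.
apply/funext => i; rewrite /kr_index /coord /= /kr_next.
case: (kr (base p)) => f u v; rewrite {1 3}/kr_fun /=.
case: (unliftP ord0 i) => [j|] ->; rewrite /prolong_coord ?liftK ?unlift_none /=.
  by case: ifP => _; [|case: ifP => _]; case: j => [[|[|[]]]] //= ?;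
    rewrite /kr_fun /bump.
by case: ifP => _; [|case: ifP => _].
Qed.

Fixpoint kr_dom k : 'rV[R]_(amb_dim k) -> set 'rV[R]_(amb_dim k) :=
  match k with
  | 0 => fun=> setT
  | k'.+1 => fun p => prolong_dom (monster k') (coord (base p)) (kr_dom (base p))
               (kr_index p)
  end.

Lemma coord0E (p : 'rV[R]_(amb_dim 0)) i q : coord p i q = q 0 i.
Proof.
by case: i => [[|[|[|[]]]] //= il]; rewrite /coord /kr_fun /=; congr (q _ _);
  apply: val_inj.
Qed.

Lemma chart0 (p : 'rV[R]_(amb_dim 0)) :
  chart (monster 0) (coord p) (kr_dom p) (fun i _ => delta_mx 0 i)
    (fun i _ => delta_mx 0 i).
Proof.
have dotd (i : 'I_3) w : dot (delta_mx 0 i) w = w 0 i :> R.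
  rewrite /dot (bigD1 i)//= big1 ?addr0 => [|j ji]; first by rewrite mxE !eqxx mul1r.
  by rewrite mxE (negbTE ji) andbF mul0r.
have coordE i : coord p i = fun q => q 0 i by apply/funext => q; exact: coord0E.
split=> //.
- by move=> c _ _; exact: filterE.
- by move=> i; rewrite coordE; exact: regular_coord.
- by move=> i j; exact: (regular_cst _ ((delta_mx 0 i : 'rV[R]_3) 0 j)).
- move=> i c t cd _; rewrite dotd mxE coordE; exact: derivable_is_derive1.
- by move=> i j; exact: (regular_cst _ ((delta_mx 0 i : 'rV[R]_3) 0 j)).
- move=> q w _; split=> [_|_].
    by exists (w 0); rewrite -row_sum_delta.
  have lin j : (fun t => (q + t *: w) 0 j) = horner ((q 0 j)%:P + w 0 j *: 'X).
    by apply/funext => t; rewrite !mxE hornerD hornerC hornerZ hornerX mulrC.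
  exists (fun t => q + t *: w); split; [split|by rewrite scale0r addr0|].
  + by apply/smooth_germP => j; rewrite lin; exact: smooth0_horner.
  + exact: filterE.
  + apply/rowP => j; rewrite mxE lin (is_derive1E (is_derive_poly _ 0)).
    by rewrite derivD derivC add0r derivZ derivX hornerZ hornerC mulr1.
- by move=> q i j _; rewrite dotd mxE eqxx eq_sym.
- move=> q Q _ Qq; have QE j : (fun t => (\row_i (Q i).[t]) 0 j) = horner (Q j).
    by apply/funext => t; rewrite mxE.
  exists (fun t => \row_i (Q i).[t]); split; [split| |].
  + by apply/smooth_germP => j; rewrite QE; exact: smooth0_horner.
  + exact: filterE.
  + by apply/rowP => j; rewrite mxE Qq coord0E.
  + apply: filterE => t; split=> [|i]; last by rewrite coord0E mxE.
    rewrite [LHS]row_sum_delta; apply: eq_bigr => j _; congr (_ *: _).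
    by rewrite mxE QE -derivE.
Qed.

(** The last branch of [kr_next] tests nothing; it is sound because df, du, dv coframe Delta_k and
    cannot all vanish on a line. *)
Lemma kr_index_nonvanishing k (p : 'rV[R]_(amb_dim k.+1)) W G X :
  chart (monster k) (coord (base p)) W G X -> W (base p) -> P k.+1 p ->
  nonvanishing (P k) (coord (base p) (kr_index p)) (base p) (line p).
Proof.
move=> ch Wp Pp; rewrite /kr_index.
case: asboolP => // v0; case: asboolP => // v1.
have [_ pM _] := Pp; have [lu u0] := line_projector_nz_row pM.
exists (nz_row (line_mx p)) => //; apply: contraNneq u0 => d2.
have dE := line_differential ch _ Pp Wp lu.
have z i : ~ nonvanishing (P k) (coord (base p) i) (base p) (line p) ->
    dot (G i (base p)) (nz_row (line_mx p)) = 0.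
  move=> vi; apply/eqP; rewrite -dE; apply/negPn/negP => di; apply: vi.
  by exists (nz_row (line_mx p)).
rewrite (chart_dist_coord ch Wp (line_dist Pp lu)) big1// => i _.
suff -> : dot (G i (base p)) (nz_row (line_mx p)) = 0 by rewrite scale0r.
case: (unliftP ord0 i) => [j|] ->; last exact: z.
case: (unliftP ord0 j) => [l|] ->; last exact: z.
have -> : lift ord0 (lift ord0 l) = o2 by apply: val_inj; case: l => [[]].
by rewrite -dE.
Qed.

Theorem monster_chart k (p : 'rV[R]_(amb_dim k)) : P k p ->
  kr_dom p p /\ exists G X, chart (monster k) (coord p) (kr_dom p) G X.
Proof.
elim: k p => [p _|k IH p Pp]; first by split=> //; do 2 eexists; exact: (chart0 p).
have [Pb _ _] := Pp; have [bb [G [X ch]]] := IH _ Pb.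
split; last by rewrite coord_prolong; exact: (chart_prolong ch (kr_index p)).
by split=> //; exact: (kr_index_nonvanishing ch).
Qed.

Definition dcoord k (p : 'rV[R]_(amb_dim k)) i (q w : 'rV[R]_(amb_dim k)) : R :=
  differential (P k) (coord p i) q w.

Definition integral k (c : R -> 'rV[R]_(amb_dim k)) : Prop :=
  smooth_curve_in (P k) c /\ \forall t \near (0 : R), Delta k (c t) (velocity c t).

(** * Delta_k described by the differentials of the Kumpera-Rubin coordinates *)

Section Level.
Variables (k : nat) (p : 'rV[R]_(amb_dim k)).
Hypothesis Pp : P k p.

Lemma kr_dom_self : kr_dom p p. Proof. by have [] := monster_chart Pp. Qed.

Lemma kr_dom_open c : smooth_curve_in (P k) c -> kr_dom p (c 0) ->
  \forall t \near (0 : R), kr_dom p (c t).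
Proof. by have [_ [G [X ch]]] := monster_chart Pp; exact: (chart_open ch). Qed.

Lemma Delta_lin q x y w w' : kr_dom p q -> Delta k q w -> Delta k q w' ->
  Delta k q (x *: w + y *: w').
Proof. by have [_ [G [X ch]]] := monster_chart Pp; exact: (dist_lin ch). Qed.

Lemma dcoord_lin q i x y w w' : kr_dom p q -> Delta k q w -> Delta k q w' ->
  dcoord p i q (x *: w + y *: w') = x * dcoord p i q w + y * dcoord p i q w'.
Proof.
have [_ [G [X ch]]] := monster_chart Pp; move=> qd qw qw'.
by rewrite /dcoord !(differentialE ch)// ?dotDr ?dotZr//; apply: (dist_tangent ch);
  rewrite //; apply: (dist_lin ch).
Qed.

Lemma dcoord_inj q w w' : kr_dom p q -> Delta k q w -> Delta k q w' ->
  (forall i, dcoord p i q w = dcoord p i q w') -> w = w'.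
Proof.
have [_ [G [X ch]]] := monster_chart Pp; move=> qd qw qw' ww'.
rewrite (chart_dist_coord ch qd qw) (chart_dist_coord ch qd qw').
apply: eq_bigr => i _; congr (_ *: _); have := ww' i.
by rewrite /dcoord !(differentialE ch)//; exact: (dist_tangent ch).
Qed.

Lemma dcoord_surj q (a : 'I_3 -> R) : kr_dom p q ->
  exists2 w, Delta k q w & forall i, dcoord p i q w = a i.
Proof.
have [_ [G [X ch]]] := monster_chart Pp; move=> qd.
have qw : Delta k q (\sum_i a i *: X i q) by apply/(chart_dist ch _ qd); exists a.
exists (\sum_i a i *: X i q) => // i.
by rewrite /dcoord (differentialE ch)// ?(dot_frame ch)//; exact: (dist_tangent ch).
Qed.

Lemma dcoord_velocity c i : smooth_curve_in (P k) c -> kr_dom p (c 0) ->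
  derive1 (fun t => coord p i (c t)) 0 = dcoord p i (c 0) (velocity c 0).
Proof.
have [_ [G [X ch]]] := monster_chart Pp; move=> cP c0.
have [_ /is_derive1E ->] := nbhs_singleton (chart_along ch i cP c0).
by rewrite /dcoord (differentialE ch)//; exists c.
Qed.

Lemma dcoord_along c i : integral c -> kr_dom p (c 0) ->
  \forall t \near (0 : R), is_derive t (1 : R) (fun s => coord p i (c s))
    (dcoord p i (c t) (velocity c t)).
Proof.
have [_ [G [X ch]]] := monster_chart Pp; move=> [cP cD] c0.
apply: filterS2 (chart_along ch i cP c0) cD => t [Wt td] tD.
by rewrite /dcoord (differentialE ch)//; exact: (dist_tangent ch).
Qed.

Lemma smooth0_coord c i : smooth_curve_in (P k) c -> kr_dom p (c 0) ->
  smooth0 (fun t => coord p i (c t)).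
Proof.
have [_ [G [X ch]]] := monster_chart Pp; move=> cP c0.
exact: smooth0_regular cP.1 (chart_open ch cP c0) (chart_F ch i).
Qed.

Lemma linear_curve q (a : 'I_3 -> R) : kr_dom p q ->
  exists c, [/\ integral c, c 0 = q &
    \forall t \near (0 : R), forall i, dcoord p i (c t) (velocity c t) = a i].
Proof.
have [_ [G [X ch]]] := monster_chart Pp; move=> qd.
have [c [cP c0 cv]] := chart_linear_curve ch a qd.
have cd : \forall t \near (0 : R), kr_dom p (c t).
  by apply: (chart_open ch cP); rewrite c0.
have cD : \forall t \near (0 : R), Delta k (c t) (velocity c t).
  apply: filterS2 cv cd => t [-> _] td.
  by apply/(chart_dist ch _ td); exists a.
exists c; split=> //; apply: filterS3 cv cd cD => t [vE _] td tD i.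
rewrite /dcoord (differentialE ch)//; last exact: (dist_tangent ch).
by rewrite vE (dot_frame ch).
Qed.

End Level.

(** * Coordinates of level k + 1 against those of level k *)

Section NextLevel.
Variables (k : nat) (p : 'rV[R]_(amb_dim k.+1)).
Hypothesis Pp : P k.+1 p.
Local Notation a := (kr_index p).

Lemma base_pts : P k (base p). Proof. by have [] := Pp. Qed.

Lemma kr_dom_base q : kr_dom p q -> kr_dom (base p) (base q).
Proof. by case. Qed.

Lemma line_Delta q u : P k.+1 q -> line q u -> Delta k (base q) u.
Proof. by case=> _ _; apply. Qed.

Lemma coord_next0 q : coord p ord0 q = coord (base p) a (base q).
Proof. by rewrite coord_prolong prolong_coord0. Qed.

Lemma line_nondegenerate q : kr_dom p q ->
  exists2 u, line q u & dcoord (base p) a (base q) u != 0.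
Proof. by case=> _ _ [u]; exists u. Qed.

Lemma dcoord_line q u j : kr_dom p q -> line q u ->
  dcoord (base p) (lift a j) (base q) u =
  coord p (lift ord0 j) q * dcoord (base p) a (base q) u.
Proof.
have [_ [G [X ch]]] := monster_chart base_pts; move=> qd qu.
have [qP qW _] := qd; rewrite coord_prolong prolong_coordS /dcoord.
rewrite !(line_differential ch)//.
have [->|u0] := eqVneq u 0; first by rewrite !dot0r mulr0.
by rewrite (ratioE ch a _ qP qW qu u0) divfK// (dot_line_neq0 ch).
Qed.

Lemma dcoord_line_eq0 q u : kr_dom p q -> line q u ->
  dcoord (base p) a (base q) u = 0 -> u = 0.
Proof.
have [_ [G [X ch]]] := monster_chart base_pts; move=> qd qu.
have [qP qW _] := qd; rewrite /dcoord (line_differential ch)// => d0.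
apply/eqP; apply: contra_eqT d0 => u0; exact: (dot_line_neq0 ch qd).
Qed.

Lemma integral_base (c : R -> 'rV[R]_(amb_dim k.+1)) : integral c ->
  integral (fun t => base (c t)) /\
  \forall t \near (0 : R), line (c t) (velocity (fun t => base (c t)) t).
Proof.
move=> [cP cD].
have cl : \forall t \near (0 : R), line (c t) (velocity (fun t => base (c t)) t).
  by apply: filterS cD => t [_]; rewrite velocity_base.
split=> //; split; first exact: smooth_curve_base.
by apply: filterS2 cP.2 cl => t; exact: line_Delta.
Qed.

Lemma derive_next0 c : integral c -> kr_dom p (c 0) ->
  \forall t \near (0 : R), derive1 (fun t => coord p ord0 (c t)) t =
    dcoord (base p) a (base (c t)) (velocity (fun t => base (c t)) t).
Proof.
move=> ci c0; have [bi _] := integral_base ci.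
apply: filterS (dcoord_along base_pts a bi (kr_dom_base c0)) => t /is_derive1E <-.
by congr (derive1 _ t); apply/funext => s; rewrite coord_next0.
Qed.

(** The contact equations dg = u df and dh = v df, where f, u, v are the coordinates of level k + 1,
    pulled back to an integral curve. *)
Lemma derive_nextS c j : integral c -> kr_dom p (c 0) ->
  \forall t \near (0 : R),
    derive1 (fun t => coord (base p) (lift a j) (base (c t))) t =
    coord p (lift ord0 j) (c t) * derive1 (fun t => coord p ord0 (c t)) t.
Proof.
move=> ci c0; have [bi bl] := integral_base ci.
apply: filterS (filterI (filterI (derive_next0 ci c0) bl)
  (filterI (dcoord_along base_pts (lift a j) bi (kr_dom_base c0))
           (kr_dom_open Pp ci.1 c0))) => t [[-> tl] [/is_derive1E -> td]].
exact: dcoord_line.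
Qed.

End NextLevel.

Lemma kr_index_eq0 k (p : 'rV[R]_(amb_dim k.+1))
    (u : 'rV[R]_(amb_dim k)) (i : 'I_3) :
  P k.+1 p -> line p u ->
  (i < kr_index p)%N -> dcoord (base p) i (base p) u = 0.
Proof.
move=> Pp pu; apply: contraTeq => di.
have vi : nonvanishing (P k) (coord (base p) i) (base p) (line p) by exists u.
rewrite /kr_index; case: asboolP => // v0; case: asboolP => v1.
  case: (unliftP ord0 i) vi => [j|] -> vi; last by case: v0.
  by rewrite -leqNgt; case: j {vi} => [[|[|[]]]].
case: (unliftP ord0 i) vi => [j|] -> vi; last by case: v0.
case: (unliftP ord0 j) vi => [l|] -> vi; last by case: v1.
by rewrite -leqNgt; case: l {vi} => [[]].
Qed.

End Tower.

(** * Critical planes *)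

Section BabyMonsters.
Local Open Scope classical_set_scope.
Local Open Scope ring_scope.
Context {R : realType}.

Local Notation P k := (pts (monster (R := R) k)).
Local Notation Delta k := (dist (monster (R := R) k)).
Local Notation baby := (@baby_monster R).

Lemma tangent_sub n (Z Z' : set 'rV[R]_n) q : Z `<=` Z' -> tangent Z q `<=` tangent Z' q.
Proof.
move=> ZZ w [c [[cs cZ] c0 cw]]; exists c; split=> //; split=> //.
by apply: filterS cZ => t; exact: ZZ.
Qed.

Lemma velocity_cst_near n (c : R -> 'rV[R]_n) :
  (\forall t \near (0 : R), c t = c 0) -> velocity c 0 = 0.
Proof.
move=> cc; apply/rowP => j; rewrite !mxE (@derive1_near _ _ (fun=> c 0 0 j)).
  by rewrite derive1_cst.
by apply: filterS cc => t ->.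
Qed.

Lemma fiber_tangent k (p : 'rV[R]_(amb_dim k.+1)) q w :
  tangent (fiber p) q w -> tangent (P k.+1) q w /\ base w = 0.
Proof.
move=> qw; split; first by apply: tangent_sub qw => r [].
have [c [[cs cZ] c0 <-]] := qw; rewrite -velocity_base velocity_cst_near//.
have [_ b0] := nbhs_singleton cZ.
by apply: filterS cZ => t [_ ->].
Qed.

Lemma baby_sub k (B : dspace (amb_dim k)) : baby B ->
  pts B `<=` P k /\ forall q, pts B q -> dist B q `<=` Delta k q.
Proof.
elim=> {k B} [k p Pp|k B _ [BP BD]].
  split=> [q []//|q _ w /fiber_tangent[qw bw]].
  by split=> //; rewrite bw; exact: sub0mx.
have BP' : pts (prolongation B) `<=` P k.+1.
  move=> q [qB qM ql]; split=> //; first exact: BP.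
  by move=> w /ql; exact: BD.
split=> // q qB w [qw lw]; split=> //; exact: tangent_sub qw.
Qed.

(** The second half says that B absorbs integral curves with F_s constant. It produces the curves
    inside B required by tangent vectors, which makes the first half inductive, and later the curves
    realising critical directions. *)
Definition baby_plane k (B : dspace (amb_dim k)) (p : 'rV[R]_(amb_dim k)) (s : 'I_3) :=
  (forall q, pts B q -> kr_dom p q ->
     forall w, dist B q w <-> Delta k q w /\ dcoord p s q w = 0) /\
  (forall c, integral c -> pts B (c 0) -> kr_dom p (c 0) ->
     (\forall t \near (0 : R), derive1 (fun t => coord p s (c t)) t = 0) ->
     \forall t \near (0 : R), pts B (c t)).

(** On the integral curve from q with constant differentials dF_i(w), the function F_s is constant,
    so the curve stays in Z. *)
Lemma plane_tangent k (Z : set 'rV[R]_(amb_dim k)) (p : 'rV[R]_(amb_dim k)) s q w :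
  P k p -> Z `<=` P k -> kr_dom p q -> Z q ->
  (forall c, integral c -> Z (c 0) -> kr_dom p (c 0) ->
     (\forall t \near (0 : R), derive1 (fun t => coord p s (c t)) t = 0) ->
     \forall t \near (0 : R), Z (c t)) ->
  Delta k q w -> dcoord p s q w = 0 -> tangent Z q w.
Proof.
move=> Pp ZP qd qZ ZI qw w0.
have [c [ci c0 cv]] := linear_curve Pp (fun i => dcoord p i q w) qd.
have cd : kr_dom p (c 0) by rewrite c0.
exists c; split=> //.
  split; first exact: ci.1.1.
  apply: ZI => //; first by rewrite c0.
  apply: filterS2 (dcoord_along Pp s ci cd) cv => t /is_derive1E -> ->.
  by rewrite w0.
apply: (dcoord_inj Pp qd) => //; first by have := nbhs_singleton ci.2; rewrite c0.
by move=> i; have := nbhs_singleton cv i; rewrite c0.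
Qed.

Lemma dcoord_tangent_cst k (Z : set 'rV[R]_(amb_dim k)) (p : 'rV[R]_(amb_dim k)) s q w x :
  P k p -> Z `<=` P k -> kr_dom p q -> (forall r, Z r -> kr_dom p r -> coord p s r = x) ->
  tangent Z q w -> dcoord p s q w = 0.
Proof.
move=> Pp ZP qd Zx [c [[cs cZ] c0 <-]].
have cP : smooth_curve_in (P k) c by split=> //; apply: filterS cZ => t; exact: ZP.
have cd0 : kr_dom p (c 0) by rewrite c0.
rewrite -c0 -(dcoord_velocity Pp s cP cd0) (@derive1_near _ _ (fun=> x)).
  by rewrite derive1_cst.
by apply: filterS2 cZ (kr_dom_open Pp cP cd0) => t; exact: Zx.
Qed.

(** The differential of f_(k+1) is injective on the lines of the chart domain. So if f_(k+1) is
    constant along an integral curve, the base point does not move and the curve stays in the fiber;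
    conversely f_(k+1) is constant on the fiber. *)
Lemma baby_plane_birth k (p0 p : 'rV[R]_(amb_dim k.+1)) :
  P k.+1 p -> fiber p0 p -> @baby_plane k.+1 (full_dspace (fiber p0)) p ord0.
Proof.
move=> Pp p0p.
have stay c : integral c -> fiber p0 (c 0) -> kr_dom p (c 0) ->
     (\forall t \near (0 : R), derive1 (fun t => coord p ord0 (c t)) t = 0) ->
     \forall t \near (0 : R), fiber p0 (c t).
  move=> ci [_ c0b] cd cc; have [bi bl] := integral_base ci.
  have : \forall t \near (0 : R), base (c t) = base (c 0).
    apply: near_cst_of_velocity; have bd := smooth_germ_derivable bi.1.1.
    apply: filterS (filterI (filterI bl bd)
      (filterI (filterI cc (derive_next0 Pp ci cd)) (kr_dom_open Pp ci.1 cd))).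
    move=> t [[tl tb] [[t0 tE] td]]; split=> //.
    by apply: (dcoord_line_eq0 Pp td tl); rewrite -tE.
  by apply: filterS2 ci.1.2 => t tP tb; split=> //; rewrite tb.
split=> // q qf qd w; split=> [qw|[qw w0]].
  have [qw' bw] := fiber_tangent qw; split.
    by split=> //; rewrite bw; exact: sub0mx.
  apply: (dcoord_tangent_cst (Z := fiber p0) (x := coord (base p) (kr_index p) (base p0)))
    => // [r []//|r [_ rb] _].
  by rewrite coord_next0 rb.
by apply: (plane_tangent (p := p) (s := ord0)) => // r [].
Qed.

(** If B has plane {dg = 0}, the lines in the prolonged B satisfy dg / df_(k+1) = 0. Conversely, if
    this ratio stays 0 along an integral curve, then g is constant below, so the base curve stays in
    B, and the lines lie in its planes. *)
Lemma baby_plane_prolong k (B : dspace (amb_dim k)) (p : 'rV[R]_(amb_dim k.+1)) j :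
  baby B -> P k.+1 p -> baby_plane B (base p) (lift (kr_index p) j) ->
  @baby_plane k.+1 (prolongation B) p (lift ord0 j).
Proof.
move=> bB Pp [Bdist Bstay].
have [_ BD] := baby_sub bB.
have [BP' _] := baby_sub (baby_prolong bB).
have zero (q : 'rV[R]_(amb_dim k.+1)) :
    pts (prolongation B) q -> kr_dom p q -> coord p (lift ord0 j) q = 0.
  move=> [qB _ ql] qd; have [u qu u0] := line_nondegenerate qd.
  have [_] := (Bdist _ qB (kr_dom_base qd) _).1 (ql _ qu).
  rewrite (dcoord_line Pp)// => /eqP; rewrite mulf_eq0 (negbTE u0) orbF.
  by move/eqP.
have stay (c : R -> 'rV[R]_(amb_dim k.+1)) :
     integral c -> pts (prolongation B) (c 0) -> kr_dom p (c 0) ->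
     (\forall t \near (0 : R), derive1 (fun t => coord p (lift ord0 j) (c t)) t = 0) ->
     \forall t \near (0 : R), pts (prolongation B) (c t).
  move=> ci c0B cd cc; have [bi bl] := integral_base ci.
  have c0 : \forall t \near (0 : R), coord p (lift ord0 j) (c t) = 0.
    have : \forall t \near (0 : R),
        coord p (lift ord0 j) (c t) = coord p (lift ord0 j) (c 0).
      apply: (@derive1_eq0_near_cst _ (fun t => coord p (lift ord0 j) (c t))).
      apply: filterS2 cc (dcoord_along Pp (lift ord0 j) ci cd) => t tc td.
      by rewrite -tc (is_derive1E td).
    by apply: filterS => t ->; exact: zero.
  have bB' : \forall t \near (0 : R), pts B (base (c t)).
    apply: Bstay => //; [by have [] := c0B|exact: kr_dom_base|].
    apply: filterS2 (derive_nextS Pp j ci cd) c0 => t -> ->.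
    by rewrite mul0r.
  apply: filterS (filterI (filterI bB' c0) (filterI ci.1.2 (kr_dom_open Pp ci.1 cd))).
  move=> t [[tB t0] [tP td]]; split=> //; first by have [] := tP.
  move=> u lu; apply/(Bdist _ tB (kr_dom_base td)); split; first exact: line_Delta.
  by rewrite (dcoord_line Pp)// t0 mul0r.
split=> // q qB qd w; split=> [[qw lw]|[qw w0]].
  split; first by split=> //; exact: tangent_sub qw.
  exact: (@dcoord_tangent_cst k.+1 (pts (prolongation B)) p _ q w 0 Pp BP' qd zero qw).
split; last by have [] := qw.
exact: (@plane_tangent k.+1 (pts (prolongation B)) p _ q w Pp BP' qd qB stay qw w0).
Qed.

(* The planes {dF_i = 0} that are critical in Delta_k(p).                       *)
Fixpoint crit k : 'rV[R]_(amb_dim k) -> 'I_3 -> Prop :=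
  match k with
  | 0 => fun _ _ => False
  | k'.+1 => fun p i =>
      if unlift ord0 i is Some j then
        crit (base p) (lift (kr_index p) j) /\ @coord R k'.+1 p i p = 0
      else True
  end.

Lemma crit0 k (p : 'rV[R]_(amb_dim k.+1)) : crit p ord0.
Proof. by rewrite /= unlift_none. Qed.

Lemma critS k (p : 'rV[R]_(amb_dim k.+1)) j :
  crit p (lift ord0 j) <->
  crit (base p) (lift (kr_index p) j) /\ coord p (lift ord0 j) p = 0.
Proof. by rewrite /= liftK. Qed.

Lemma line_coord_eq0 k (p : 'rV[R]_(amb_dim k.+1)) j : P k.+1 p ->
  coord p (lift ord0 j) p = 0 <->
  forall u, line p u -> dcoord (base p) (lift (kr_index p) j) (base p) u = 0.
Proof.
move=> Pp; have pd := kr_dom_self Pp; split=> [p0 u pu|p0].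
  by rewrite (dcoord_line Pp)// p0 mul0r.
have [u pu /negbTE u0] := line_nondegenerate pd.
have /eqP := p0 u pu; rewrite (dcoord_line Pp)// mulf_eq0 u0 orbF.
by move/eqP.
Qed.

Lemma baby_crit k (B : dspace (amb_dim k)) : baby B ->
  forall p, pts B p -> exists2 s, crit p s & baby_plane B p s.
Proof.
elim=> {k B} [k p0 Pp0|k B bB IH] p Bp.
  by exists ord0; [exact: crit0|apply: baby_plane_birth; have [] := Bp].
have Pp : P k.+1 p by have [BP _] := baby_sub (baby_prolong bB); exact: BP.
have [pB _ pl] := Bp; have [s cs Bs] := IH _ pB.
have pd := kr_dom_self Pp.
have z u : line p u -> dcoord (base p) s (base p) u = 0.
  by move=> /pl /(Bs.1 _ pB (kr_dom_base pd))[].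
case: (unliftP (kr_index p) s) => [j|] sE; rewrite sE in cs Bs z.
  exists (lift ord0 j); last exact: baby_plane_prolong.
  by apply/critS; split=> //; apply/(line_coord_eq0 _ Pp).
(* The plane {df_(k+1) = 0} does not contain the line, so a Baby Monster with this plane does not
   prolong through p. *)
by have [u /z ->] := line_nondegenerate pd; rewrite eqxx.
Qed.

Lemma crit_baby k (p : 'rV[R]_(amb_dim k)) s : P k p -> crit p s ->
  exists B, [/\ baby B, pts B p & baby_plane B p s].
Proof.
elim: k p s => [//|k IH] p s Pp.
case: (unliftP ord0 s) => [j|] ->; last first.
  move=> _; exists (full_dspace (fiber p)); split; first exact: baby_birth.
    by [].
  exact: baby_plane_birth.
move=> /critS[cp p0]; have [Pb pM pl] := Pp.
have [B [bB pB Bs]] := IH _ _ Pb cp.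
exists (prolongation B); split; [exact: baby_prolong| |exact: baby_plane_prolong].
split=> // u lu; apply/(Bs.1 _ pB (kr_dom_base (kr_dom_self Pp))); split.
  exact: pl.
exact: (line_coord_eq0 _ Pp).1.
Qed.

Lemma baby_to_R3 k (B : dspace (amb_dim k)) : baby B ->
  forall p q, pts B p -> pts B q -> to_R3 p = to_R3 q.
Proof.
elim=> {k B} [k p0 _ p q [_ pb] [_ qb]|k B _ IH p q [pB _ _] [qB _ _]] /=.
  by rewrite pb qb.
exact: IH.
Qed.

End BabyMonsters.

(** * Critical directions *)

Section CriticalDirections.
Local Open Scope classical_set_scope.
Local Open Scope ring_scope.
Context {R : realType}.

Local Notation P k := (pts (monster (R := R) k)).
Local Notation Delta k := (dist (monster (R := R) k)).

Definition plane k (p : 'rV[R]_(amb_dim k)) (i : 'I_3) : set 'rV[R]_(amb_dim k) :=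
  [set w | Delta k p w /\ dcoord p i p w = 0].

Lemma dcoord0 k (p q : 'rV[R]_(amb_dim k)) i : P k p -> kr_dom p q ->
  Delta k q 0 /\ dcoord p i q 0 = 0.
Proof.
move=> Pp qd; have [w qw _] := dcoord_surj Pp (fun=> 0) qd.
have := Delta_lin Pp 0 0 qd qw qw; have := dcoord_lin Pp i 0 0 qd qw qw.
by rewrite !scale0r !mul0r !addr0.
Qed.

Lemma plane_inj k (p : 'rV[R]_(amb_dim k)) i j : P k p -> plane p i = plane p j -> i = j.
Proof.
move=> Pp ij; have [w pw wE] := dcoord_surj Pp (fun l => (l == j)%:R) (kr_dom_self Pp).
apply/eqP/negPn/negP => nij.
have : plane p i w by split=> //; rewrite wE (negbTE nij).
by rewrite ij => -[_]; rewrite wE eqxx => /eqP; rewrite oner_eq0.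
Qed.

Lemma planeVE k (p : 'rV[R]_(amb_dim k.+1)) : P k.+1 p -> planeV p = plane p ord0.
Proof.
move=> Pp; have [Bp _] := @baby_plane_birth _ _ p p Pp (conj Pp erefl).
apply/seteqP; split=> w; by move/(Bp _ (conj Pp erefl) (kr_dom_self Pp)).
Qed.

Lemma planeT1E k (p : 'rV[R]_(amb_dim k)) : planeT1 p = plane p o1.
Proof. by []. Qed.

Lemma planeT2E k (p : 'rV[R]_(amb_dim k)) : planeT2 p = plane p o2.
Proof. by []. Qed.

Lemma critical_planeP k (p : 'rV[R]_(amb_dim k)) i : P k p ->
  critical_plane p (plane p i) <-> crit p i.
Proof.
move=> Pp; have pd := kr_dom_self Pp; split=> [[B [bB pB pE]]|ci].
  have [s cs [Bs _]] := baby_crit bB pB; suff -> : i = s by [].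
  by apply: (plane_inj Pp); rewrite pE; apply/seteqP; split=> w /(Bs _ pB pd).
have [B [bB pB [Bs _]]] := crit_baby Pp ci; exists B; split=> //.
by apply/seteqP; split=> w /(Bs _ pB pd).
Qed.

Lemma has_T1P k (p : 'rV[R]_(amb_dim k.+1)) : P k.+1 p -> has_T1 p <-> crit p o1.
Proof.
move=> Pp; rewrite /has_T1 planeT1E planeVE//; split=> [[/(critical_planeP _ Pp)]//|c1].
by split; [exact/(critical_planeP _ Pp)|move/(plane_inj Pp)/(congr1 val)].
Qed.

Lemma has_T2P k (p : 'rV[R]_(amb_dim k.+1)) : P k.+1 p -> has_T2 p <-> crit p o2.
Proof.
move=> Pp; rewrite /has_T2 planeT2E planeVE//; split=> [[/(critical_planeP _ Pp)]//|c1].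
by split; [exact/(critical_planeP _ Pp)|move/(plane_inj Pp)/(congr1 val)].
Qed.

Lemma line_generator k (q : 'rV[R]_(amb_dim k.+1)) : P k.+1 q ->
  exists u, [/\ u != 0, Delta k (base q) u &
    forall w, line q w <-> exists x, w = x *: u].
Proof.
move=> Pq; have [_ qM _] := Pq; have [lu u0] := line_projector_nz_row qM.
by exists (nz_row (line_mx q)); split=> //; [exact: line_Delta|exact: line_mul].
Qed.

Lemma dcoordZ k (p q : 'rV[R]_(amb_dim k)) i x w : P k p -> kr_dom p q ->
  Delta k q w -> dcoord p i q (x *: w) = x * dcoord p i q w.
Proof.
move=> Pp qd qw; have := dcoord_lin Pp i x 0 qd qw qw.
by rewrite scale0r mul0r !addr0.
Qed.

Lemma near0_punctured (Q : R -> Prop) : (\forall t \near (0 : R), t != 0 -> Q t) ->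
  exists2 t, t != 0 & Q t.
Proof.
move=> /nbhs_ballP[e /= e0 Qe]; have e2 : e / 2 != 0 by rewrite gt_eqF// divr_gt0.
exists (e / 2) => //; apply: Qe => //.
rewrite /ball /= sub0r normrN ger0_norm ?ltr_pdivrMr ?divr_ge0 ?ltW//.
by rewrite ltr_pMr// ltr1n.
Qed.

(* Going down the tower, if no critical coordinate of level k + 1 is            *)
(* stationary at times t <> 0, then neither is any critical one of level k, and *)
(* eventually f_1, a coordinate of R^3, moves along the curve.                  *)
Lemma moving_critical_coords k (p : 'rV[R]_(amb_dim k.+1)) c :
  P k.+1 p -> integral c -> c 0 = p ->
  (forall s, crit p s -> \forall t \near (0 : R), t != 0 ->
     derive1 (fun t => coord p s (c t)) t != 0) ->
  ~ (\forall t \near (0 : R), to_R3 (c t) = to_R3 p).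
Proof.
elim: k p c => [|k IH] p c Pp ci c0 Hc cR.
  (* At level 1 the function f_1 is a coordinate of R^3, hence constant along the curve if the
     projection is. *)
  have [|t _ [/eqP dt tR]] := @near0_punctured (fun t =>
      derive1 (fun t => coord p ord0 (c t)) t != 0 /\
      \forall s \near t, to_R3 (c s) = to_R3 p).
    by apply: filterS2 (Hc _ (crit0 p)) (near_join cR) => t dt ? /dt.
  apply: dt.
  rewrite (@derive1_near _ _ (fun=> @coord R 0 (base p) (@kr_index R 0 p) (base p))).
    by rewrite derive1_cst.
  by apply: filterS tR => s /= sb; rewrite (@coord_next0 _ 0 p) sb.
have [bi _] := integral_base ci; have Pb := base_pts Pp.
have cd : kr_dom p (c 0) by rewrite c0; exact: kr_dom_self.
have F0 : \forall t \near (0 : R), t != 0 ->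
    derive1 (fun t => @coord R k.+1 (base p) (@kr_index R k.+1 p) (base (c t))) t != 0.
  apply: filterS (Hc _ (crit0 p)) => t dt /dt.
  by congr (derive1 _ t != 0); apply/funext => s; rewrite coord_next0.
have F0' := Hc _ (crit0 p).
apply: (IH (base p) (fun t => base (c t)) Pb bi) => //; first by rewrite c0.
move=> s; case: (unliftP (kr_index p) s) => [j|] -> cs; last exact: F0.
(* A ratio vanishing at p is critical at level k + 1, so it moves and Rolle's theorem makes it
   nonzero off 0; a ratio nonzero at p stays so by continuity. *)
have Fj : \forall t \near (0 : R), t != 0 -> coord p (lift ord0 j) (c t) != 0.
  have cj := smooth0_coord Pp (lift ord0 j) ci.1 cd.
  have [z|nz] := eqVneq (coord p (lift ord0 j) p) 0.
    have := near_neq_of_derive1 cj (Hc (lift ord0 j) ((critS _ _).2 (conj cs z))).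
    by rewrite c0 z.
  have := near_neq0 (smooth0_continuous cj); rewrite c0 => /(_ nz).
  by apply: filterS => t ? _.
apply: filterS3 (derive_nextS Pp j ci cd) F0' Fj => t -> d0 dj t0.
by rewrite mulf_neq0// ?d0// dj.
Qed.

Theorem critical_directionP k (p : 'rV[R]_(amb_dim k.+1)) (q : 'rV[R]_(amb_dim k.+2)) :
  P k.+2 q -> base q = p ->
  critical_direction p (line q) <-> exists2 s, crit p s & line q `<=` plane p s.
Proof.
move=> Pq bq; have Pp : P k.+1 p by rewrite -bq; exact: base_pts.
have pd := kr_dom_self Pp.
have [u [u0 pu lu]] := line_generator Pq; rewrite bq in pu.
have lqu : line q u by apply/lu; exists 1; rewrite scale1r.
split=> [[c [cP c0 lc cc]]|[s cs ls]].
  apply: contrapT => ns.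
  have ci : integral c by split=> //; apply: filterS cc => t [].
  have [v0 vD _] := nbhs_singleton cc.
  have cd : kr_dom p (c 0) by rewrite c0.
  apply: (moving_critical_coords Pp ci c0); last by apply: filterS cc => t [].
  (* Since no critical plane contains the line, each critical coordinate has nonzero derivative at
     0, hence near 0. *)
  move=> s cs; have cs0 := smooth0_coord Pp s ci.1 cd.
  have : derive1 (fun t => coord p s (c t)) 0 != 0.
    rewrite (dcoord_velocity Pp s ci.1 cd) c0; apply/eqP => d0; apply: ns.
    exists s => // w lw; split; first by rewrite -bq; exact: line_Delta.
    have [x vE] := (lu _).1 lc; have [y ->] := (lu _).1 lw.
    have x0 : x != 0 by apply: contraNneq v0 => x0; rewrite vE x0 scale0r.
    move: d0; rewrite vE !dcoordZ// => /eqP; rewrite mulf_eq0 (negbTE x0) /=.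
    by move=> /eqP ->; rewrite mulr0.
  move/(near_neq0 (smooth0_continuous (smooth0_derive1 cs0))).
  by apply: filterS => t ? _.
(* Keeping the differentials of u constant gives dF_s = 0 along c, which confines c to a Baby
   Monster, and this lies over one point of R^3. *)
have [c [ci c0 cv]] := linear_curve Pp (fun i => dcoord p i p u) pd.
have cd : kr_dom p (c 0) by rewrite c0.
have cdn := kr_dom_open Pp ci.1 cd.
have [B [bB pB [_ Bstay]]] := crit_baby Pp cs.
have cB : \forall t \near (0 : R), pts B (c t).
  apply: Bstay => //; first by rewrite c0.
  apply: filterS2 (dcoord_along Pp s ci cd) cv => t /is_derive1E -> ->.
  by have [] := ls u lqu.
exists c; split=> //; first exact: ci.1.
  suff -> : velocity c 0 = u by [].
  apply: (dcoord_inj Pp pd) => //; first by have := nbhs_singleton ci.2; rewrite c0.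
  by move=> i; have := nbhs_singleton cv i; rewrite c0.
apply: filterS (filterI (filterI cB cdn) (filterI cv ci.2)) => t [[tB td] [tv tD]].
split=> //; last exact: baby_to_R3 bB _ _ tB pB.
(* The velocity has the same differentials as u at every time, so it vanishes only if u does. *)
apply: contraNneq u0 => v0; apply/eqP; have [p0 _] := dcoord0 ord0 Pp pd.
apply: (dcoord_inj Pp pd) => // i; rewrite -tv v0.
by have [_ ->] := dcoord0 i Pp td; have [_ ->] := dcoord0 i Pp pd.
Qed.

End CriticalDirections.

(** * Spelling rules *)

Section SpellingRules.
Local Open Scope classical_set_scope.
Local Open Scope ring_scope.
Context {R : realType}.

Local Notation P k := (pts (monster (R := R) k)).
Local Notation Delta k := (dist (monster (R := R) k)).

(* c1, c2: presence of T_1, T_2; z0, z1, z2: vanishing of df, du, dv on l.     *)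
Definition letter_spec (c1 c2 z0 z1 z2 : bool) (a : letter) : bool :=
  let l1 := [&& c1, z0 & z1] in
  let l2 := [&& c1, c2, z1 & z2] in
  let l3 := [&& c2, z0 & z2] in
  let crit := [|| z0, c1 && z1 | c2 && z2] in
  let generic := ~~ [|| l1, l2 | l3] in
  match a with
  | lR => ~~ crit
  | lL1 => crit && l1
  | lL2 => crit && l2
  | lL3 => crit && l3
  | lV => [&& crit, generic & z0]
  | lT1 => [&& crit, generic, c1 & z1]
  | lT2 => [&& crit, generic, c2 & z2]
  end.

(** If df_k vanishes on l, then f_k is the first remaining function and its plane V, always
    critical, contains l, so T_1 is present. Otherwise f_(k+1) = f_k, and T_1 comes from u_k. As for
    T_2, the last function is v_k unless df_k and du_k both vanish on l; then f_(k+1) = v_k and T_2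
    is the old T_1. *)
Definition next_T1 (c1 z0 z1 : bool) : bool := z0 || (c1 && z1).
Definition next_T2 (c1 c2 z0 z1 z2 : bool) : bool :=
  if z0 && z1 then c1 else c2 && z2.

(** The state of the spelling automaton: the last letter alone decides which of T_1, T_2 are
    present. *)
Definition has_T1_after (a : letter) : bool :=
  match a with lR | lT2 => false | _ => true end.
Definition has_T2_after (a : letter) : bool :=
  match a with lR | lV | lT1 => false | _ => true end.

Definition letter_code (a : letter) : nat :=
  match a with
  | lR => 0 | lV => 1 | lT1 => 2 | lT2 => 3 | lL1 => 4 | lL2 => 5 | lL3 => 6
  end.

(* The equality test on letters is opaque; this one computes.                 *)
Lemma letter_eqE (a b : letter) : (a == b) = (letter_code a == letter_code b).
Proof. by apply/eqP/eqP => [->//|]; case: a; case: b. Qed.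

Lemma letter_spec_follows (a b : letter) z0 z1 z2 : ~~ [&& z0, z1 & z2] ->
  letter_spec (has_T1_after a) (has_T2_after a) z0 z1 z2 b ->
  [/\ b \in followers a,
      next_T1 (has_T1_after a) z0 z1 = has_T1_after b &
      next_T2 (has_T1_after a) (has_T2_after a) z0 z1 z2 = has_T2_after b].
Proof.
by case: a; case: b; rewrite ?inE ?letter_eqE /=; case: z0; case: z1; case: z2.
Qed.

Lemma followers_letter_spec (a b : letter) : b \in followers a ->
  exists z0 z1 z2, ~~ [&& z0, z1 & z2] /\
    letter_spec (has_T1_after a) (has_T2_after a) z0 z1 z2 b.
Proof.
case: a; case: b; rewrite !inE !letter_eqE //= => _; do ?[by exists false, false, false
  |by exists true, false, false|by exists false, true, false|by exists false, false, true
  |by exists true, true, false|by exists true, false, true|by exists false, true, true].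
Qed.

Lemma and3_iff (A B C : Prop) (a b c : bool) : (A <-> a) -> (B <-> b) -> (C <-> c) ->
  [/\ A, B & C] <-> [&& a, b & c].
Proof.
by case=> ? ? [? ?] [? ?]; split=> [[]|/and3P[]] *; [apply/and3P|]; split; auto.
Qed.

Lemma and4_iff (A B C D : Prop) (a b c d : bool) :
  (A <-> a) -> (B <-> b) -> (C <-> c) -> (D <-> d) ->
  [/\ A, B, C & D] <-> [&& a, b, c & d].
Proof.
by case=> ? ? [? ?] [? ?] [? ?]; split=> [[]|/and4P[]] *; [apply/and4P|]; split; auto.
Qed.

Section Direction.
Variables (k : nat) (p : 'rV[R]_(amb_dim k.+1)) (q : 'rV[R]_(amb_dim k.+2)).
Variable u : 'rV[R]_(amb_dim k.+1).
Hypotheses (Pq : P k.+2 q) (bq : base q = p) (u0 : u != 0) (pu : Delta k.+1 p u).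
Hypothesis lu : forall w, line q w <-> exists x, w = x *: u.

Local Notation z i := (dcoord p i p u == 0).

Let Pp : P k.+1 p. Proof. by rewrite -bq; exact: base_pts. Qed.
Let pd := kr_dom_self Pp.
Let lqu : line q u. Proof. by apply/lu; exists 1; rewrite scale1r. Qed.

Lemma line_sub_plane i : line q `<=` plane p i <-> z i.
Proof.
split=> [/(_ u lqu)[_ ->]//|/eqP z0 w /lu[x ->]]; split.
  by have := Delta_lin Pp x 0 pd pu pu; rewrite scale0r addr0.
by rewrite dcoordZ// z0 mulr0.
Qed.

(** Vectors in both planes are determined by the differential of the third coordinate, so the planes
    meet in a line, spanned by u once u lies in both. *)
Lemma line_eq_planes i j : i != j ->
  line q = plane p i `&` plane p j <-> z i /\ z j.
Proof.
move=> ij; split=> [lE|[zi zj]].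
  by split; apply/line_sub_plane; rewrite lE => w [].
apply/seteqP; split=> w; first by move=> lw; split; exact: (line_sub_plane _).2.
move=> [[pw wi] [_ wj]]; have third l : l != i -> l != j ->
    forall m, m != l -> z m /\ dcoord p m p w = 0.
  move=> li lj m ml; suff /orP[] : (m == i) || (m == j) by move/eqP ->.
  move: ij li lj ml; rewrite -!val_eqE /=.
  by case: i j l m {zi zj wi wj} => [[|[|[]]]//= ?] [[|[|[]]]//= ?]
    [[|[|[]]]//= ?] [[|[|[]]]//= ?].
have [l li lj] : exists2 l : 'I_3, l != i & l != j.
  case: i j ij {zi zj wi wj third} => [[|[|[|]]]//= ?] [[|[|[|]]]//= ?] ij;
  by [exists ord0|exists o1|exists o2].
have {}third := third l li lj.
have ul : dcoord p l p u != 0.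
  apply: contraNneq u0 => ul; apply/eqP; have [p0 _] := dcoord0 ord0 Pp pd.
  apply: (dcoord_inj Pp pd) => // m; have [_ ->] := dcoord0 m Pp pd.
  by have [->//|/third[/eqP]] := eqVneq m l.
apply/lu; exists (dcoord p l p w / dcoord p l p u).
have pxu : Delta k.+1 p ((dcoord p l p w / dcoord p l p u) *: u).
  by have := Delta_lin Pp (dcoord p l p w / dcoord p l p u) 0 pd pu pu;
    rewrite scale0r addr0.
apply: (dcoord_inj Pp pd) => // m; rewrite dcoordZ//.
have [->|/third[/eqP -> ->]] := eqVneq m l; first by rewrite divfK.
by rewrite mulr0.
Qed.

Lemma not_all_zero : ~~ [&& z ord0, z o1 & z o2].
Proof.
apply: contra u0 => /and3P[/eqP z0 /eqP z1 /eqP z2].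
apply/eqP; have [p0 _] := dcoord0 ord0 Pp pd.
apply: (dcoord_inj Pp pd) => // m; have [_ ->] := dcoord0 m Pp pd.
by case: (unliftP ord0 m) => [j|] -> //; case: (unliftP ord0 j) => [l|] -> //.
Qed.

Lemma direction_letterP a : direction_letter p (line q) a <->
  letter_spec `[< crit p o1 >] `[< crit p o2 >] (z ord0) (z o1) (z o2) a.
Proof.
have cE : critical_direction p (line q) <->
    [|| z ord0, `[< crit p o1 >] && z o1 | `[< crit p o2 >] && z o2].
  rewrite (critical_directionP Pq bq); split=> [[s cs /line_sub_plane zs]|].
    case: (unliftP ord0 s) cs zs => [j|] ->; last by move=> _ ->.
    have [->|->] : lift ord0 j = o1 \/ lift ord0 j = o2.
      by case: j => [[|[|[]]]//= jl]; [left|right]; apply: val_inj.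
    + by move=> c1 ->; rewrite (asboolT c1) orbT.
    + by move=> c2 ->; rewrite (asboolT c2) !orbT.
  case/or3P => [z0|/andP[/asboolP c1 z1]|/andP[/asboolP c2 z2]].
  + by exists ord0; [exact: crit0|apply/line_sub_plane].
  + by exists o1 => //; apply/line_sub_plane.
  + by exists o2 => //; apply/line_sub_plane.
have L1 : is_L1 p (line q) <-> [&& `[< crit p o1 >], z ord0 & z o1].
  rewrite /is_L1 planeVE// planeT1E (has_T1P Pp) line_eq_planes//.
  by split=> [[/asboolP-> [-> ->]]|/and3P[/asboolP]].
have L2 : is_L2 p (line q) <->
    [&& `[< crit p o1 >], `[< crit p o2 >], z o1 & z o2].
  rewrite /is_L2 planeT2E planeT1E; split.
    move=> [h1 h2 lE].
    have /asboolP-> := (has_T1P Pp).1 h1.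
    have /asboolP-> := (has_T2P Pp).1 h2.
    by have [-> ->] := (line_eq_planes (isT : o1 != o2)).1 lE.
  move=> /and4P[/asboolP c1 /asboolP c2 z1 z2].
  by split; [exact/(has_T1P Pp)|exact/(has_T2P Pp)|exact/line_eq_planes].
have L3 : is_L3 p (line q) <-> [&& `[< crit p o2 >], z ord0 & z o2].
  rewrite /is_L3 planeVE// planeT2E (has_T2P Pp) line_eq_planes//.
  by split=> [[/asboolP-> [-> ->]]|/and3P[/asboolP]].
have LE : ~ is_L p (line q) <-> ~~ [|| [&& `[< crit p o1 >], z ord0 & z o1],
    [&& `[< crit p o1 >], `[< crit p o2 >], z o1 & z o2]
    | [&& `[< crit p o2 >], z ord0 & z o2]].
  rewrite /is_L; split=> [nL|/negP nL].
    by apply/negP => /or3P[/L1|/L2|/L3] ?; apply: nL;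
      [exact: Or31|exact: Or32|exact: Or33].
  by case=> [/L1 l|/L2 l|/L3 l]; apply: nL; rewrite l ?orbT.
have SV : line q `<=` planeV p <-> z ord0 by rewrite planeVE//; exact: line_sub_plane.
have S1 : line q `<=` planeT1 p <-> z o1 by rewrite planeT1E; exact: line_sub_plane.
have S2 : line q `<=` planeT2 p <-> z o2 by rewrite planeT2E; exact: line_sub_plane.
have T1 : has_T1 p <-> `[< crit p o1 >].
  by rewrite (has_T1P Pp); split=> /asboolP.
have T2 : has_T2 p <-> `[< crit p o2 >].
  by rewrite (has_T2P Pp); split=> /asboolP.
case: a; rewrite /direction_letter /letter_spec.
- by rewrite cE; split=> [/negP|/negP].
- exact: and3_iff cE LE SV.
- exact: and4_iff cE LE T1 S1.
- exact: and4_iff cE LE T2 S2.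
- by rewrite cE L1; split=> [[-> ->]|/andP[]].
- by rewrite cE L2; split=> [[-> ->]|/andP[]].
- by rewrite cE L3; split=> [[-> ->]|/andP[]].
Qed.

Lemma crit_next j : crit q (lift ord0 j) <->
  crit p (lift (@kr_index R k.+1 q) j) /\ z (lift (@kr_index R k.+1 q) j).
Proof.
rewrite (@critS R k.+1 q j) (@line_coord_eq0 R k.+1 q j Pq) bq.
split=> -[cj]; first by move=> /(_ u lqu) ->.
by move=> /line_sub_plane zj; split=> // w /zj[].
Qed.

Lemma kr_indexE : @kr_index R k.+1 q =
  if z ord0 then if z o1 then o2 else o1 else ord0.
Proof.
set i := kr_index q.
have zi : ~~ z i.
  have [w] := @line_nondegenerate R k.+1 q q (kr_dom_self Pq).
  rewrite bq => /lu[x ->]; rewrite dcoordZ//.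
  by apply: contraNneq => ->; rewrite mulr0.
have zlt (l : 'I_3) : (l < i)%N -> z l.
  by move=> li; have := @kr_index_eq0 R k.+1 q u l Pq lqu li; rewrite bq => ->.
case: (unliftP ord0 i) zi zlt => [j|] -> zi zlt; last by rewrite (negbTE zi).
rewrite (zlt ord0)//; case: (unliftP ord0 j) zi zlt => [l|] -> zi zlt.
  rewrite (zlt o1)//.
  by apply: val_inj; case: l {zi zlt} => [[]].
by rewrite (negbTE zi).
Qed.

Lemma next_T1P : `[< crit q o1 >] = next_T1 `[< crit p o1 >] (z ord0) (z o1).
Proof.
rewrite /next_T1; apply/asboolP/idP; rewrite crit_next kr_indexE.
  by case: (z ord0) => //= -[/asboolP-> ->].
have E i : i != ord0 -> lift i (ord0 : 'I_2) = ord0.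
  by rewrite -val_eqE /= => i0; apply: val_inj; rewrite /= /bump leqn0 (negbTE i0).
case: (boolP (z ord0)) => /= [z0 _|_ /andP[/asboolP]//].
by case: (z o1); rewrite E//; split=> //; exact: crit0.
Qed.

Lemma next_T2P : `[< crit q o2 >] =
  next_T2 `[< crit p o1 >] `[< crit p o2 >] (z ord0) (z o1) (z o2).
Proof.
have E1 : lift o1 (ord_max : 'I_2) = o2 by apply: val_inj.
have E2 : lift o2 (ord_max : 'I_2) = o1 by apply: val_inj.
rewrite /next_T2; apply/asboolP/idP; rewrite crit_next kr_indexE.
  case: (z ord0) => /=; last by case=> /asboolP-> ->.
  case: (boolP (z o1)) => /= _; first by rewrite E2 => -[/asboolP].
  by rewrite E1 => -[/asboolP-> ->].
case: (z ord0) => /=; last by case/andP=> /asboolP.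
case: (boolP (z o1)) => /= z1; first by rewrite E2 => /asboolP.
by rewrite E1 => /andP[/asboolP].
Qed.

End Direction.

(** Every direction in Delta_k is a point of the next level, so vanishing patterns may be prescribed
    freely on vectors. *)
Lemma point_over k (p u : 'rV[R]_(amb_dim k)) : P k p -> u != 0 -> Delta k p u ->
  exists q : 'rV[R]_(amb_dim k.+1), [/\ P k.+1 q, base q = p &
    forall w, line q w <-> exists x, w = x *: u].
Proof.
move=> Pp u0 pu; exists (row_mx p (mxvec (proj_mx u))).
have lE w : line (row_mx p (mxvec (proj_mx u))) w <-> exists x, w = x *: u.
  by rewrite /line line_row_mx; exact: rowspace_proj_mx.
split; [split| |by []]; rewrite ?base_row_mx ?line_row_mx//.
  exact: line_projector_proj_mx.
move=> w /lE[x ->]; have pd := kr_dom_self Pp.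
by have := Delta_lin Pp x 0 pd pu pu; rewrite scale0r addr0.
Qed.

(** * Admissible words and codes of points *)

Definition spelling_rules (k : nat) (w : seq letter) : Prop :=
  nth lR w 0 = lR /\
  forall i : nat, (1 <= i < k)%N -> nth lR w i \in followers (nth lR w i.-1).

Lemma spelling_rules_rcons k w a : size w = k.+1 ->
  spelling_rules k.+2 (rcons w a) <->
  spelling_rules k.+1 w /\ a \in followers (last lR w).
Proof.
move=> sw; have lw : last lR w = nth lR w k by rewrite (last_nth lR) sw.
rewrite lw; split=> [[w0 wi]|[[w0 wi] wa]].
  split; first split.
  - by move: w0; rewrite nth_rcons sw.
  - move=> i /andP[i1 ik]; have := wi i; rewrite i1 ltnS ltnW// => /(_ isT).
    by rewrite !nth_rcons sw ik (leq_ltn_trans (leq_pred i) ik).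
  - have := wi k.+1; rewrite ltnSn => /(_ isT).
    by rewrite !nth_rcons sw ltnn eqxx /= ltnSn.
split=> [|i]; first by rewrite nth_rcons sw.
move=> /andP[i1]; rewrite ltnS leq_eqVlt => /orP[/eqP->|ik].
  by rewrite !nth_rcons sw ltnn eqxx /= ltnSn.
by rewrite !nth_rcons sw ik (leq_ltn_trans (leq_pred i) ik); apply: wi; rewrite i1.
Qed.

(** The rules alone are not inductive; the presence of T_1 and T_2 at p, read off from the last
    letter, is carried along. *)
Lemma RVT_code_sound k (p : 'rV[R]_(amb_dim k)) w : RVT_code p w -> P k p ->
  [/\ size w = k, spelling_rules k w, `[< crit p o1 >] = has_T1_after (last lR w) &
     `[< crit p o2 >] = has_T2_after (last lR w)].
Proof.
elim=> {k p w} [p _|k q w a _ IH qa Pq].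
  split=> //; first by split=> // i; case: i => [|[|]].
    by apply/asboolP => /critS[].
  by apply/asboolP => /critS[].
have [sw rw c1 c2] := IH (base_pts Pq).
have [u [u0 pu lu]] := line_generator Pq.
have /(direction_letterP Pq erefl u0 pu lu) := qa; rewrite c1 c2.
move=> /(letter_spec_follows (not_all_zero Pq erefl u0 pu))[af n1 n2].
split; first by rewrite size_rcons sw.
- by apply/spelling_rules_rcons.
- by rewrite (next_T1P Pq erefl pu lu) c1 n1 last_rcons.
- by rewrite (next_T2P Pq erefl pu lu) c1 c2 n2 last_rcons.
Qed.

Lemma RVT_code_complete k w : size w = k.+1 -> spelling_rules k.+1 w ->
  exists p : 'rV[R]_(amb_dim k.+1), P k.+1 p /\ RVT_code p w.
Proof.
elim: k w => [|k IH] w.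
  case: w => [//|b [|//]] _ [/= -> _].
  have P0 : P 0 0 by [].
  (* Every point of level 1 has code R, so any nonzero vector of R^3 will do. *)
  have [u pu uE] := dcoord_surj P0 (fun=> 1) (kr_dom_self P0).
  have u0 : u != 0.
    apply/eqP => u0; have := uE ord0; rewrite u0.
    have [_ ->] := dcoord0 ord0 P0 (kr_dom_self P0).
    by move/eqP; rewrite eq_sym oner_eq0.
  have [q [Pq _ _]] := point_over P0 u0 pu.
  by exists q; split=> //; exact: RVT_first.
case/lastP: w => [//|w a]; rewrite size_rcons => -[sw].
move=> /(spelling_rules_rcons a sw)[rw af].
have [p [Pp pw]] := IH w sw rw.
have [_ _ c1 c2] := RVT_code_sound pw Pp.
have [z0 [z1 [z2 [nz la]]]] := followers_letter_spec af.
have pd := kr_dom_self Pp.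
(* A vector whose differentials are 0 or 1 according to the vanishing pattern that produces the
   letter a. *)
have [u pu uE] := dcoord_surj Pp (fun i : 'I_3 =>
  (~~ (if i == ord0 then z0 else if i == o1 then z1 else z2))%:R) pd.
have zE i : (dcoord p i p u == 0) =
    (if i == ord0 then z0 else if i == o1 then z1 else z2).
  by rewrite uE; case: (if _ then _ else _); rewrite ?eqxx ?oner_eq0.
have u0 : u != 0.
  apply: contraNneq nz => u0.
  have ui i : dcoord p i p u == 0 by rewrite u0; have [_ ->] := dcoord0 i Pp pd.
  by have := zE ord0; have := zE o1; have := zE o2; rewrite !ui /= => <- <- <-.
have [q [Pq bq lu]] := point_over Pp u0 pu.
exists q; split=> //; apply: (@RVT_next R k q w a); rewrite bq//.
by apply/(direction_letterP Pq bq u0 pu lu); rewrite c1 c2 !zE.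
Qed.

End SpellingRules.

Theorem theorem2p2 (R : realType) (k : nat) (w : seq letter)
    (hk : (1 <= k)%N) (hw : size w = k) :
  (exists p : 'rV[R]_(amb_dim k), pts (monster k) p /\ RVT_code p w)
  <->
  (nth lR w 0 = lR /\
   forall i : nat, (1 <= i < k)%N -> nth lR w i \in followers (nth lR w i.-1)).
Proof.
case: k hk hw => // k _ sw; split=> [[p [Pp pw]]|].
  by have [] := RVT_code_sound pw Pp.
exact: RVT_code_complete.
Qed.
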